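(* Let $n\ge 2$, $1\le r,s\le n-1$ and $p=\lfloor rs/n\rfloor$. Assume that $p=0$, or that $r+s\ge n$ and $p=r+s-n$. Identify $X=\lambda\backslash\!\backslash G(r,n)^{ss}_{\lambda}(\mathcal L(\varpi_r))$ with $H\times_{P_{s,r}}\mathbb P(M_{s-p,r-p})$. For $1\le t\le\min\{r-p,s-p\}$ let $Y_t=\{[A]\in\mathbb P(M_{s-p,r-p}):\operatorname{rank}(A)=t\}$ and $O_t=H\times_{P_{s,r}}Y_t$. Then: (1) for each $1\le t\le\min\{r-p,s-p\}$, $O_t$ is an $H$-orbit in $X$, and these are the $H$-orbits in $X$; (2) the number of $H$-orbits in $X$ is $\min\{r-p,s-p\}$; (3) $O_{t_1}\subset\overline{O_{t_2}}$ if and only if $t_1\le t_2$.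
   Context: Work over $\mathbb C$. $G=SL(n,\mathbb C)$, $T$ = diagonal torus, $B\supset T$ = upper triangular Borel subgroup, $S=\{\alpha_1,\dots,\alpha_{n-1}\}$ the simple roots, $s_i$ the simple reflections, $\varpi_i$ the fundamental weights. $P=P_{S\setminus\{\alpha_r\}}\supset B$ is the maximal parabolic omitting $\alpha_r$, $G/P=G(r,n)$ the Grassmannian of $r$-dimensional subspaces of $\mathbb C^n$, and $\mathcal L(\varpi_r)$ the Plücker line bundle with its natural $G$-linearization. $X(w)=\overline{BwP/P}$ are the Schubert varieties. $\lambda(t)=\operatorname{diag}(t^{n-s},\dots,t^{n-s},t^{-s},\dots,t^{-s})$ ($s$ entries $t^{n-s}$, $n-s$ entries $t^{-s}$). $X$ is the GIT quotient $\operatorname{Proj}\bigoplus_{d\ge0}H^0(G(r,n),\mathcal L(\varpi_r)^{\otimes d})^{\lambda(\mathbb G_m)}$ of the $\lambda$-semistable locus $G(r,n)^{ss}_\lambda(\mathcal L(\varpi_r))$. $H=SL(s,\mathbb C)\times SL(n-s,\mathbb C)\subset G$ (block diagonal) commutes with $\lambda$ and acts on $X$. $w_{s,r}=(s_s\cdots s_{p+1})(s_{s+1}\cdots s_{p+2})\cdots(s_{s+r-p-1}\cdots s_r)$, and $P_{s,r}=\operatorname{Stab}_G(X(w_{s,r}))\cap H$. $M_{s-p,r-p}$ is the space of $(s-p)\times(r-p)$ complex matrices, identified with the Schubert cell $Bw_{s,r}P/P$ by sending $A$ to the span of $e_1,\dots,e_p$ and $e_{s+j}+\sum_{i=1}^{s-p}A_{ij}e_{p+i}$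 ($1\le j\le r-p$); $\lambda(t)$ acts on $A$ by the scalar $t^n$, and $\mathbb P(M_{s-p,r-p})=\lambda\backslash\!\backslash X(w_{s,r})^{ss}_\lambda(\mathcal L(\varpi_r))$ carries the induced $P_{s,r}$-action. For $Z$ a $P_{s,r}$-variety, $H\times_{P_{s,r}}Z=(H\times Z)/\sim$ with $(h,z)\sim(hq^{-1},qz)$ for $q\in P_{s,r}$, with $H$ acting on the left. Under the stated assumption on $p$, the map $[(h,y)]\mapsto h\cdot y$ is an isomorphism $H\times_{P_{s,r}}\mathbb P(M_{s-p,r-p})\cong X$. *)

(* Defs.v *)
From HB Require Import structures.
From mathcomp Require Import all_boot all_order all_algebra.
From mathcomp Require Import all_classical reals complex mpoly.

Set Implicit Arguments.
Unset Strict Implicit.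
Unset Printing Implicit Defensive.

Import GRing.Theory.
Local Open Scope ring_scope.
Local Open Scope classical_set_scope.

(** * Proj of a graded ring *)

Section Proj.
Variables (A : comPzRingType) (gr : nat -> set A).

(* The graded ring is the direct sum of the subgroups [gr d] of [A]; a
   homogeneous ideal is given by its graded pieces. *)
Definition homog_ideal (I : nat -> set A) : Prop :=
  [/\ forall d, I d `<=` gr d,
      forall d, I d 0,
      forall d f g, I d f -> I d g -> I d (f - g)
    & forall d e a f, gr d a -> I e f -> I (d + e)%N (a * f)].

Definition homog_prime (I : nat -> set A) : Prop :=
  [/\ homog_ideal I,
      ~ I 0%N 1
    & forall d e a b, gr d a -> gr e b -> I (d + e)%N (a * b) ->
        I d a \/ I e b].

Definition Proj : set (nat -> set A) :=
  [set x | homog_prime x /\ exists d, (0 < d)%N /\ ~ gr d `<=` x d].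

Definition zariski_closed (Z : set (nat -> set A)) : Prop :=
  exists2 J, homog_ideal J &
    Z = [set x | Proj x /\ forall d, J d `<=` x d].

Definition closed_points : set (nat -> set A) :=
  [set x | Proj x /\ zariski_closed [set x]].

(* closure for the subspace topology on the set of closed points *)
Definition zariski_closure (S : set (nat -> set A)) : set (nat -> set A) :=
  closed_points `&` smallest zariski_closed S.

End Proj.

(** * The group SL(n) *)

Record SL (C : fieldType) (n : nat) :=
  MkSL { SLval :> 'M[C]_n; SL_det : \det SLval == 1 }.

HB.instance Definition _ (C : fieldType) (n : nat) :=
  [isSub for @SLval C n].
HB.instance Definition _ (C : fieldType) (n : nat) :=
  [Choice of SL C n by <:].

Section SLGroup.
Variables (C : fieldType) (n : nat).
Implicit Types g h : SL C n.

Fact SL_one_det : \det (1%:M : 'M[C]_n) == 1.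
Proof. by rewrite det1. Qed.

Fact SL_mul_det g h : \det (g *m h) == 1.
Proof. by rewrite det_mulmx (eqP (SL_det g)) (eqP (SL_det h)) mulr1. Qed.

Fact SL_inv_det g : \det (invmx g) == 1.
Proof. by rewrite det_inv (eqP (SL_det g)) invr1. Qed.

Definition SL_one : SL C n := MkSL SL_one_det.
Definition SL_mul g h : SL C n := MkSL (SL_mul_det g h).
Definition SL_inv g : SL C n := MkSL (SL_inv_det g).

Fact SL_unitmx g : (g : 'M[C]_n) \in unitmx.
Proof. by rewrite unitmxE (eqP (SL_det g)) unitr1. Qed.

Fact SL_mulA : associative SL_mul.
Proof. by move=> g h k; apply: val_inj; rewrite /= mulmxA. Qed.
Fact SL_mul1 : left_id SL_one SL_mul.
Proof. by move=> g; apply: val_inj; rewrite /= mul1mx. Qed.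
Fact SL_mulr1 : right_id SL_one SL_mul.
Proof. by move=> g; apply: val_inj; rewrite /= mulmx1. Qed.
Fact SL_mulV : left_inverse SL_one SL_inv SL_mul.
Proof. by move=> g; apply: val_inj; rewrite /= mulVmx ?SL_unitmx. Qed.
Fact SL_mulrV : right_inverse SL_one SL_inv SL_mul.
Proof. by move=> g; apply: val_inj; rewrite /= mulmxV ?SL_unitmx. Qed.

HB.instance Definition _ := isGroup.Build (SL C n)
  SL_mulA SL_mul1 SL_mulr1 SL_mulV SL_mulrV.

End SLGroup.

Section Setup.
Variables (C : fieldType) (n : nat).
Implicit Types (g h u : SL C n) (W : {vspace 'cV[C]_n}).

(* An n x n matrix in 2 x 2 block form, the upper left block being k x k; it
   is only used for k <= n, where the dimensions k + (n - k) and n agree. *)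
Definition blockn (k : nat) (a : 'M[C]_k) (b : 'M[C]_(k, n - k))
    (c : 'M[C]_(n - k, k)) (d : 'M[C]_(n - k)) : 'M[C]_n :=
  conform_mx 0 (block_mx a b c d).

Definition Bgrp : set (SL C n) := [set b | is_trig_mx (b : 'M[C]_n)^T].

(* the coordinate ring of SL(n) *)
Definition regular_fun : set (SL C n -> C) :=
  [set f | exists q : {mpoly C[n * n]}, f = fun g => q.@[mxvec g 0]].

(** ** The Grassmannian G(r,n) = G/P *)

(* e_i, numbered from 1 *)
Definition evec (i : nat) : 'cV[C]_n := \col_a (a.+1 == i)%:R.

Definition SLact g W : {vspace 'cV[C]_n} :=
  (linfun (mulmx (g : 'M[C]_n)) @: W)%VS.

Definition base_pt (r : nat) : {vspace 'cV[C]_n} :=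
  <<[seq evec i | i <- iota 1 r]>>%VS.

Definition Gr (r : nat) : set {vspace 'cV[C]_n} := [set W | \dim W = r].

(* Quotient topology of G/P: Z is closed iff its preimage under
   g |-> g <e_1, ..., e_r> is closed in SL(n). *)
Definition Gr_closed (r : nat) (Z : set {vspace 'cV[C]_n}) : Prop :=
  Z `<=` Gr r /\
  exists2 F : set (SL C n -> C), F `<=` regular_fun &
    forall g, Z (SLact g (base_pt r)) <-> forall f, F f -> f g = 0.

(* H^0(G/P, L(varpi_r)^d): the regular functions f on SL(n) such that
   f(gu) = varpi_r(u)^d f(g) for u in the block upper triangular group P.
   The character varpi_r of P is the determinant of the upper left r x r block,
   so for d = 1 the Plücker coordinates (the r x r minors of the first r
   columns of g) are such functions. *)
Definition sections (r d : nat) : set (SL C n -> C) :=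
  [set f | regular_fun f /\
    forall g u (a : 'M[C]_r) (b : 'M[C]_(r, n - r)) (c : 'M[C]_(n - r)),
      (u : 'M[C]_n) = blockn a b 0 c -> f (g * u)%g = \det a ^+ d * f g].

(** ** The GIT quotient by lambda *)

Definition lambda (s : nat) (t : C) : 'M[C]_n :=
  diag_mx (\row_j if (j < s)%N then t ^+ (n - s) else t ^- s).

Definition lambda_Gm (s : nat) : set (SL C n) :=
  [set u | exists2 t, t != 0 & (u : 'M[C]_n) = lambda s t].

Definition inv_sections (r s d : nat) : set (SL C n -> C) :=
  [set f | sections r d f /\
           forall u g, lambda_Gm s u -> f (u * g)%g = f g].

Definition Xgit (r s : nat) : set (nat -> set (SL C n -> C)) :=
  closed_points (inv_sections r s).

(* The point of X under W: the homogeneous ideal of the invariant sections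
   vanishing at W.  It contains the irrelevant ideal when W is not
   semistable. *)
Definition quot_pt (r s : nat) W : nat -> set (SL C n -> C) :=
  fun d => [set f | inv_sections r s d f /\
                    forall g, SLact g (base_pt r) = W -> f g = 0].

(* The left action of H: h . (ideal of W) = ideal of h W. *)
Definition pt_act (r s : nat) h (x : nat -> set (SL C n -> C)) :
    nat -> set (SL C n -> C) :=
  fun d => [set f | inv_sections r s d f /\ x d (fun g => f (h * g)%g)].

Definition Hgrp (s : nat) : set (SL C n) :=
  [set h | exists (a : 'M[C]_s) (b : 'M[C]_(n - s)),
    [/\ \det a = 1, \det b = 1 & (h : 'M[C]_n) = blockn a 0 0 b]].

Definition H_orbit (r s : nat) (x : nat -> set (SL C n -> C)) :
    set (nat -> set (SL C n -> C)) :=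
  [set pt_act r s h x | h in Hgrp s].

Definition H_orbits (r s : nat) : set (set (nat -> set (SL C n -> C))) :=
  [set H_orbit r s x | x in Xgit r s].

(** ** The Schubert variety X(w_{s,r}) *)

Definition simple_refl (i : nat) : nat -> nat :=
  fun x => if x == i then i.+1 else if x == i.+1 then i else x.

(* the permutation of the positive integers given by the word
   [:: i_1; ...; i_l], i.e. the composite s_{i_1} o ... o s_{i_l} *)
Definition word_act (l : seq nat) (x : nat) : nat := foldr simple_refl x l.

(* (s_s ... s_{p+1}) (s_{s+1} ... s_{p+2}) ... (s_{s+r-p-1} ... s_r) *)
Definition w_word (r s p : nat) : seq nat :=
  flatten [seq rev (iota (p + j) (s - p)) | j <- iota 1 (r - p)].

(* closure of B w P / P, where w P / P = <e_{w(1)}, ..., e_{w(r)}> *)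
Definition schubert (r : nat) (w : nat -> nat) : set {vspace 'cV[C]_n} :=
  smallest (Gr_closed r)
    [set SLact b <<[seq evec (w i) | i <- iota 1 r]>>%VS | b in Bgrp].

Definition P_sr (r s p : nat) : set (SL C n) :=
  [set g | SLact g @` schubert r (word_act (w_word r s p))
             = schubert r (word_act (w_word r s p))] `&` Hgrp s.

(** ** P(M_{s-p,r-p}) in X, and the sets O_t *)

Definition cell_pt (r s p : nat) (A : 'M[C]_(s - p, r - p)) :
    {vspace 'cV[C]_n} :=
  <<[seq evec i | i <- iota 1 p] ++
    [seq (evec (s + j.+1) + \sum_(i < s - p) A i j *: evec (p + i.+1))%R
      | j : 'I_(r - p)]>>%VS.

(* A nonzero matrix A represents the point [A] of P(M_{s-p,r-p}), which is
   regarded as the image of cell_pt A in X. *)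
Definition Yset (r s p t : nat) : set (nat -> set (SL C n -> C)) :=
  [set quot_pt r s (cell_pt A) | A in [set A : 'M[C]_(s - p, r - p) |
                                       \rank A = t]].

Definition assoc_class (r s p : nat) h (z : nat -> set (SL C n -> C)) :
    set (SL C n * (nat -> set (SL C n -> C))) :=
  [set ((h * q^-1)%g, pt_act r s q z) | q in P_sr r s p].

(* H x_{P_{s,r}} Z, as a set of equivalence classes in H x Z *)
Definition assoc_bundle (r s p : nat) (Z : set (nat -> set (SL C n -> C))) :
    set (set (SL C n * (nat -> set (SL C n -> C)))) :=
  [set c | exists h z, [/\ Hgrp s h, Z z & c = assoc_class r s p h z]].

(* H x_{P_{s,r}} Y_t, as a subset of X through [(h, y)] |-> h . y *)
Definition Oset (r s p t : nat) : set (nat -> set (SL C n -> C)) :=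
  [set pt_act r s hy.1 hy.2 | hy in \bigcup_(c in assoc_bundle r s p
                                               (Yset r s p t)) c].

End Setup.

(* Main.v *)
(* A point g of SL(n) has two rank invariants: the ranks of the upper s and of
   the lower n - s rows of its first r columns.  By linear algebra they are the
   only invariants under H, lambda and the right action of P.  The weight of a
   section under lambda, computed on normal forms, shows that the semistable
   points are those with lower rank r - p and upper rank p + t, 1 <= t, and a
   monomial in two Plücker coordinates separates the values of t; this gives
   the orbits, and scaling t2 - t1 of the ones of the normal form to 0 gives
   the closure relations.

   That every closed point of Proj comes from a semistable g is proved as
   follows.  If the sections in a homogeneous prime x have no common zero
   outside that of a section sigma, the Nullstellensatz on the affine charts of
   the Grassmannian writes each p_f^N sigma^M, p_f a Plücker coordinate, as a
   combination of elements of x with coefficients in the ring of Plücker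
   coordinates.  Multiplication by sigma^M thus maps the span of the Plücker
   monomials of some degree into itself with coefficients in the ideal
   generated by x, and by the determinant trick a power of sigma lies in that
   ideal; its part of lambda-weight 0 is in x.  The Nullstellensatz itself is
   proved by Zorn's lemma and the uncountability of the base field. *)
From HB Require Import structures.
From mathcomp Require Import all_boot all_order all_algebra.
From mathcomp Require Import perm all_classical reals complex mpoly.
From mathcomp Require Import ring zify.
Require Import Defs.

Set Implicit Arguments.
Unset Strict Implicit.
Unset Printing Implicit Defensive.

Import Order.TTheory GRing.Theory Num.Theory.
Local Open Scope ring_scope.
Local Open Scope classical_set_scope.

(** The two cases of the hypothesis on [p] amount to one: with truncated subtraction
    [p = r + s - n], and [n * p < r * s < n * p.+1]. The equation says that [r - p] is the largest
    lower rank that occurs. A frame of lower rank [r - k] has lambda-weight [n * k - r * s], so the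
    right inequality destabilises every smaller lower rank and the left one destabilises upper rank
    [p].

    Sections are regular functions on SL(n), and they are not shown to be polynomials in the Plücker
    coordinates. The common-zero argument therefore reaches [sigma ^+ M] only after multiplication
    by Plücker coordinates; these have no common zero, and the determinant trick removes them. The
    resulting relation involves words that are not invariant, but lambda acts on each word by a
    power of [t], so comparing coefficients in [t] replaces a Reynolds operator.

    Limits are algebraic throughout: a polynomial in [t] that vanishes for [t != 0] is zero. That
    the [O_t] are distinct is deduced from the closure relations. *)

(** * Uncountability of the real and complex numbers *)

Lemma uncountable_real (R : realType) : ~ countable [set: R].
Proof.
move=> /pcard_leTP/injPex[f finj].
have [e eK] : exists e : nat -> R, forall x, e (f x) = x.
  exists (fun k => if pselect (exists x, f x = k) is left ex
                   then projT1 (cid ex) else 0) => x.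
  case: pselect => [ex|[]]; last by exists x.
  by case: (cid ex) => y /= /finj; apply; rewrite inE.
pose mid (u : R * R) := (u.1 + u.2) / 2.
(* The new closed interval misses [e k]. In the second case [e k] may be the midpoint itself, so the
   right end is taken strictly to its left. A point common to all the intervals is then outside the
   range of [e]. *)
pose step k (u : R * R) := if e k < mid u then (mid u, u.2)
                           else (u.1, mid (u.1, mid u)).
pose I := fix I k := if k is k'.+1 then step k' (I k') else (0, 1).
have midP u : u.1 < u.2 -> u.1 < mid u < u.2.
  by move=> lt_u; rewrite !midf_lt.
have I_lt k : (I k).1 < (I k).2.
  elim: k => [|k IH] /=; first exact: ltr01.
  have /andP[lt1 lt2] := midP _ IH; rewrite /step; case: ifP => _ //=.
  by have /andP[] := midP (_, mid (I k)) lt1.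
have I_sub k : (I k).1 <= (I k.+1).1 /\ (I k.+1).2 <= (I k).2.
  have /andP[lt1 lt2] := midP _ (I_lt k); rewrite /= /step; case: ifP => _ /=.
    by split=> //; apply: ltW.
  have /andP[_ lt3] := midP (_, mid (I k)) lt1.
  by split=> //; apply/ltW/(lt_trans lt3).
have I_mon k l : (k <= l)%N -> (I k).1 <= (I l).1 /\ (I l).2 <= (I k).2.
  elim: l => [|l IH]; first by rewrite leqn0 => /eqP->.
  rewrite leq_eqVlt => /predU1P[->//|]; rewrite ltnS => /IH[le1 le2].
  by have [le3 le4] := I_sub l; split; [apply: le_trans le3|apply: le_trans le2].
pose S := [set (I k).1 | k in [set: nat]].
have ubS k : ubound S (I k).2.
  move=> _ [l _ <-]; have [le1 _] := I_mon l _ (leq_maxl l k).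
  have [_ le2] := I_mon k _ (leq_maxr l k).
  exact: le_trans le1 (le_trans (ltW (I_lt _)) le2).
have S0 : S !=set0 by exists 0, 0%N.
have le_sup k : (I k).1 <= sup S.
  by apply: ub_le_sup; [exists (I 0%N).2|exists k].
have sup_le k : sup S <= (I k).2 by apply: ge_sup.
have := le_sup (f (sup S)).+1; have := sup_le (f (sup S)).+1.
have /andP[lt1 lt2] := midP _ (I_lt (f (sup S))).
have /andP[_ lt3] := midP (_, mid _) lt1.
rewrite /= /step eK; case: ltP => [lt4 _|le4 /= le5 _] /=; first by rewrite leNgt lt4.
by have := lt_le_trans lt3 (le_trans le4 le5); rewrite ltxx.
Qed.

Lemma uncountable_complex (R : realType) : ~ countable [set: R[i]].
Proof.
move=> cC; apply: (@uncountable_real R).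
have -> : [set: R] = (@complex.Re R) @` [set: R[i]].
  by apply/seteqP; split=> // x _; exists (x%:C)%C.
exact: sub_countable (card_image_le _ _) cC.
Qed.

(** Identities along lambda hold for [t != 0] only. This turns them into identities of polynomials,
    in which coefficients can be compared or [t = 0] substituted. *)
Lemma poly_eq0_nonzero (C : numFieldType) (p : {poly C}) :
  (forall t, t != 0 -> p.[t] = 0) -> p = 0.
Proof.
move=> pt; apply/eqP/negP => /negP pn0.
have := max_poly_roots pn0 (rs := [seq i.+1%:R | i <- iota 0 (size p)]).
rewrite size_map size_iota ltnn => H; suff: false by [].
apply: H.
  by apply/allP => _ /mapP[i _ ->]; rewrite rootE pt // pnatr_eq0.
rewrite map_inj_uniq ?iota_uniq // => i j /eqP.
by rewrite eqr_nat eqSS => /eqP.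
Qed.

Lemma mpoly_ring_ind (R : comNzRingType) (m : nat) (P : {mpoly R[m]} -> Prop) :
  (forall c, P c%:MP) -> (forall i, P 'X_i) ->
  (forall q q', P q -> P q' -> P (q + q')) ->
  (forall q q', P q -> P q' -> P (q * q')) -> forall q, P q.
Proof.
move=> PC PX PD PM; elim/mpolyind => [|c k q _ _ Pq]; first by rewrite -mpolyC0.
apply: PD => //; rewrite -mul_mpolyC; apply: (PM) => //; rewrite mpolyXE_id.
elim/big_ind: _ => [|//|i _]; first by rewrite -mpolyC1.
by elim: (k i) => [|e IH]; rewrite ?expr0 -?mpolyC1 // exprS; apply: PM.
Qed.

(** * The Nullstellensatz over an uncountable algebraically closed field *)

Section Nullstellensatz.
Variables (C : numClosedFieldType) (m : nat).
Hypothesis uncountableC : ~ countable [set: C].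
Implicit Types (I J : set {mpoly C[m]}) (q h : {mpoly C[m]}).

Definition mideal I := [/\ I 0, forall q q', I q -> I q' -> I (q + q')
  & forall a q, I q -> I (a * q)].

Lemma mideal_sum I (T : Type) (s : seq T) (P : pred T) (F : T -> {mpoly C[m]}) :
  mideal I -> (forall i, P i -> I (F i)) -> I (\sum_(i <- s | P i) F i).
Proof. by move=> [I0 ID _] IF; elim/big_ind: _. Qed.

(** Maximality among the ideals avoiding all powers of [h], rather than among proper ideals, yields
    a zero at which [h] does not vanish without Rabinowitsch's extra variable. *)
Definition avoids h J := forall M, ~ J (h ^+ M).

Lemma maximal_avoiding I h : mideal I -> avoids h I ->
  exists J, [/\ mideal J, I `<=` J, avoids h J &
    forall J', mideal J' -> J `<=` J' -> avoids h J' -> J' = J].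
Proof.
move=> idI avI.
pose P : set (set {mpoly C[m]}) := [set J | J = set0 \/
   [/\ mideal J, I `<=` J & avoids h J]].
have [F FP Ftot|J [PJ maxJ]] := @Zorn_bigcup _ P.
  have [[J0 [FJ0 J0n0]]|F0] := pselect (exists J, F J /\ J <> set0); last first.
    left; apply/seteqP; split=> // q [J FJ Jq].
    by case: F0; exists J; split=> // J0; rewrite J0 in Jq.
  right.
  have idF J : F J -> J <> set0 -> [/\ mideal J, I `<=` J & avoids h J].
    by move=> FJ Jn; case: (FP _ FJ).
  have ne J q : J q -> J <> set0 by move=> Jq J0'; rewrite J0' in Jq.
  have [[J00 _ _] IJ0 _] := idF _ FJ0 J0n0.
  split; [split|..].
  - by exists J0.
  - move=> q q' [J FJ Jq] [J' FJ' Jq'].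
    have [JJ'|J'J] := Ftot _ _ FJ FJ'.
      exists J' => //; have [[_ D _] _ _] := idF _ FJ' (ne _ _ Jq').
      by apply: D => //; apply: JJ'.
    exists J => //; have [[_ D _] _ _] := idF _ FJ (ne _ _ Jq).
    by apply: D => //; apply: J'J.
  - move=> a q [J FJ Jq]; exists J => //.
    by have [[_ _ D] _ _] := idF _ FJ (ne _ _ Jq); apply: D.
  - by move=> q Iq; exists J0 => //; apply: IJ0.
  - move=> M [J FJ Jq]; have [_ _] := idF _ FJ (ne _ _ Jq).
    by move=> /(_ M).
have PI : P I by right; split.
have Jn0 : J <> set0.
  move=> J0; apply: (maxJ I) => //; rewrite J0.
  split=> // sub; have [I0 _ _] := idI; exact: (sub 0).
case: PJ => // -[idJ IJ avJ]; exists J; split=> // J' idJ' JJ' avJ'.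
apply/seteqP; split=> //; apply: contrapT => nsub.
apply: (maxJ J'); first by split.
by right; split=> // q Iq; apply/JJ'/IJ.
Qed.

(** The ideal generated by [J] and [f] is strictly larger than [J], so it contains a power of [h]:
    modulo [J], [f] becomes invertible once [h] is inverted. *)
Lemma maximal_avoiding_inv J h : mideal J -> avoids h J ->
  (forall J', mideal J' -> J `<=` J' -> avoids h J' -> J' = J) ->
  forall f, ~ J f -> exists u M, J (u * f - h ^+ M).
Proof.
move=> [J0 JD JM] avJ maxJ f nJf.
have JN q : J q -> J (- q) by move=> Jq; rewrite -mulN1r; apply: JM.
pose J' := [set q | exists u j, J j /\ q = u * f + j].
have idJ' : mideal J'.
  split.
  - by exists 0, 0; rewrite mul0r addr0.
  - move=> _ _ [u [j [Jj ->]]] [u' [j' [Jj' ->]]]; exists (u + u'), (j + j').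
    by split; [apply: JD|rewrite mulrDl addrACA].
  - move=> a _ [u [j [Jj ->]]]; exists (a * u), (a * j).
    by split; [apply: JM|rewrite mulrDr mulrA].
have JJ' : J `<=` J' by move=> q Jq; exists 0, q; rewrite mul0r add0r.
have [avJ'|] := pselect (avoids h J').
  case: nJf; rewrite -(maxJ _ idJ' JJ' avJ'); exists 1, 0.
  by rewrite mul1r addr0.
move=> /existsNP[M /contrapT [u [j [Jj E]]]]; exists u, M.
by rewrite E opprD addrA subrr add0r; apply: JN.
Qed.

Lemma maximal_avoiding_prime J h : mideal J -> avoids h J ->
  (forall J', mideal J' -> J `<=` J' -> avoids h J' -> J' = J) ->
  forall f f', J (f * f') -> J f \/ J f'.
Proof.
move=> idJ avJ maxJ f f' Jff'; apply: contrapT => /not_orP[nf nf'].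
have [J0 JD JM] := idJ.
have [u [M Ju]] := maximal_avoiding_inv idJ avJ maxJ nf.
have [u' [M' Ju']] := maximal_avoiding_inv idJ avJ maxJ nf'.
apply: (avJ (M + M')%N).
have -> : h ^+ (M + M') = u * u' * (f * f') + (- (u' * f')) * (u * f - h ^+ M)
    + (- h ^+ M) * (u' * f' - h ^+ M').
  rewrite exprD; ring.
by apply: (JD); [apply: (JD)|]; apply: JM.
Qed.

(* Polynomials have countable dimension and [C] is uncountable, so infinitely
   many of the [u c] lie in one finite-dimensional space. *)
Lemma dependent_inverses (u : C -> {mpoly C[m]}) (M : C -> nat) :
  exists (D : nat) (c : 'I_D -> C) (a : 'I_D -> C) (N : nat),
    [/\ injective c, exists i, a i != 0, forall i, M (c i) = N
      & \sum_i (a i)%:MP * u (c i) = 0].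
Proof.
pose fib (k : nat * nat) := [set c | (M c, msize (u c)) = k].
have [k infk] : exists k, infinite_set (fib k).
  apply: contrapT => /forallNP fin; apply: uncountableC.
  have -> : [set: C] = \bigcup_(k in [set: nat * nat]) fib k.
    by apply/seteqP; split=> // c _; exists (M c, msize (u c)).
  apply: bigcup_countable => // k _; apply: finite_set_countable.
  exact: contrapT (fin k).
have [B Bk leB] := infinite_set_fset #|{: 'X_{1..m < k.2}}|.+1 infk.
pose D := #|{: 'X_{1..m < k.2}}|.
pose c (i : 'I_D.+1) := (finmap.enum_fset B)`_i.
have ltB (i : 'I_D.+1) : (i < size (finmap.enum_fset B))%N.
  exact: leq_trans (ltn_ord i) leB.
have kc i : (M (c i), msize (u (c i))) = k by apply: Bk; apply: mem_nth.
pose A : 'M[C]_(D.+1, D) :=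
  \matrix_(i, j) (u (c i))@_(val (enum_val j : 'X_{1..m < k.2})).
have [a aA a0] : exists2 a : 'rV[C]_D.+1, a *m A = 0 & a != 0.
  have : kermx A != 0.
    by rewrite -mxrank_eq0 mxrank_ker subn_eq0 -ltnNge ltnS rank_leq_col.
  move=> /rowV0Pn[a /sub_kermxP aA a0]; by exists a.
exists D.+1, c, (a 0), k.1; split.
- move=> i j /eqP; rewrite /c nth_uniq ?finmap.fset_uniq // => /eqP; exact: val_inj.
- by have /rV0Pn := a0.
- by move=> i; rewrite -(kc i).
- apply/mpolyP => mm; rewrite mcoeff0 raddf_sum /=.
  have [lt|ge] := ltnP (mdeg mm) k.2; last first.
    rewrite big1 // => i _; rewrite mcoeffCM memN_msupp_eq0 ?mulr0 //.
    by apply: contraTN ge => /msize_mdeg_lt; rewrite -ltnNge -(kc i).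
  have := congr1 (fun X : 'rV_D => X 0 (enum_rank (BMultinom lt))) aA.
  rewrite !mxE => E; rewrite -[RHS]E; apply: eq_bigr => i _.
  by rewrite mcoeffCM mxE enum_rankK.
Qed.

(** If no ['X_i - c] lies in [J], each has an inverse [u c] up to a power of [h]. A linear relation
    between finitely many of these, with a common exponent [N], reads
    [h ^+ N * \sum_j a j / ('X_i - c j) = 0] modulo [J]. Clearing denominators puts a nonzero
    polynomial in ['X_i] into the prime [J], and it splits into linear factors. *)
Lemma maximal_avoiding_rat J h : mideal J -> avoids h J ->
  (forall J', mideal J' -> J `<=` J' -> avoids h J' -> J' = J) ->
  forall i, exists c, J ('X_i - c%:MP).
Proof.
move=> idJ avJ maxJ i; apply: contrapT => /forallNP nJ.
have [J0 JD JM] := idJ.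
have JN q : J q -> J (- q) by move=> Jq; rewrite -mulN1r; apply: JM.
have prJ := maximal_avoiding_prime idJ avJ maxJ.
have /choice[u] := fun c => maximal_avoiding_inv idJ avJ maxJ (nJ c).
move=> /choice[M JuM].
have [D [c [a [N [cinj [i0 ai0] cN dep]]]]] := dependent_inverses u M.
(* The numerator of [\sum_j a j / ('X - c j)]. At [c i0] only the term [i0] survives, whence
   [Q != 0]. *)
pose Q : {poly C} := \sum_j a j *: \prod_(l | l != j) ('X - (c l)%:P).
have Q0 : Q != 0.
  apply: contraNneq ai0 => /(congr1 (fun q : {poly C} => q.[c i0])).
  rewrite horner0 horner_sum (bigD1 i0) //= [X in _ + X]big1 ?addr0; last first.
    move=> j ji0; rewrite hornerZ horner_prod (bigD1 i0) 1?eq_sym //=.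
    by rewrite hornerXsubC subrr mul0r mulr0.
  rewrite hornerZ => /eqP; rewrite mulf_eq0 => /orP[//|]; rewrite horner_prod.
  move=> /prodf_eq0[l li0]; rewrite hornerXsubC subr_eq0 => /eqP/cinj E.
  by rewrite E eqxx in li0.
pose ev (q : {poly C}) : {mpoly C[m]} := (map_poly (@mpolyC m C) q).['X_i].
have evXC z : ev ('X - z%:P) = 'X_i - z%:MP.
  by rewrite /ev rmorphB /= map_polyX map_polyC /= hornerXsubC.
have evM (q q' : {poly C}) : ev (q * q') = ev q * ev q' by rewrite /ev rmorphM hornerM.
have ev1 : ev 1 = 1 by rewrite /ev rmorph1 hornerC.
have JQ : J (ev Q).
  have [JhN|//] : J (h ^+ N) \/ J (ev Q); last by case: (avJ N).
  apply: prJ; rewrite /Q.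
  have -> : ev (\sum_j a j *: \prod_(l | l != j) ('X - (c l)%:P)) =
      \sum_j (a j)%:MP * \prod_(l | l != j) ('X_i - (c l)%:MP).
    rewrite /ev raddf_sum horner_sum; apply: eq_bigr => j _ /=.
    rewrite map_polyZ hornerZ; congr (_ * _).
    apply: (big_ind2 (fun (q : {poly C}) q' => ev q = q')) => //.
    by move=> x1 x2 y1 y2 <- <-.
  rewrite mulr_sumr.
  have /(congr1 (fun q => q * \prod_l ('X_i - (c l)%:MP))) := dep.
  rewrite mul0r mulr_suml => dep'.
  set S := (X in J X); have -> : S = S - 0 by rewrite subr0.
  rewrite -[X in _ - X]dep' /S -sumrB; apply: (mideal_sum _ idJ) => j _.
  rewrite [in X in _ - X](bigD1 j) //=.
  set P := \prod_(l | _) _.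
  have -> : h ^+ N * ((a j)%:MP * P) - (a j)%:MP * u (c j) *
      (('X_i - (c j)%:MP) * P) = (- ((a j)%:MP * P)) *
      (u (c j) * ('X_i - (c j)%:MP) - h ^+ M (c j)) by rewrite cN; ring.
  exact: JM.
have [rs Qrs] := closed_field_poly_normal Q.
have: J (ev (\prod_(z <- rs) ('X - z%:P))).
  have -> : \prod_(z <- rs) ('X - z%:P) = (lead_coef Q)^-1%:P * Q.
    by rewrite [X in _ * X]Qrs mul_polyC scalerA mulVf ?lead_coef_eq0 // scale1r.
  by rewrite evM; apply: JM.
elim: rs {Qrs} => [|z rs IH]; first by rewrite big_nil ev1; apply: (avJ 0%N).
by rewrite big_cons evM evXC => /prJ[/nJ|].
Qed.

(** Since [J] contains every ['X_i - v i], each polynomial is congruent modulo [J] to its value at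
    [v]. A nonzero value of an element of [I] would put [1 = h ^+ 0] into [J], and the value 0 of
    [h] would put [h] itself there. *)
Theorem nullstellensatz I h : mideal I -> avoids h I ->
  exists v, (forall q, I q -> q.@[v] = 0) /\ h.@[v] != 0.
Proof.
move=> idI avI; have [J [idJ IJ avJ maxJ]] := maximal_avoiding idI avI.
have [J0 JD JM] := idJ.
have /choice[v Jv] := maximal_avoiding_rat idJ avJ maxJ.
have Jev q : J (q - q.@[v]%:MP).
  elim/mpoly_ring_ind: q => [c|i|q q' IH IH'|q q' IH IH'].
  - by rewrite mevalC subrr.
  - by rewrite mevalXU.
  - by rewrite mevalD mpolyCD opprD addrACA; apply: JD.
  - rewrite mevalM mpolyCM.
    have -> : q * q' - q.@[v]%:MP * q'.@[v]%:MP =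
      q' * (q - q.@[v]%:MP) + q.@[v]%:MP * (q' - q'.@[v]%:MP) by ring.
    by apply: JD; apply: JM.
exists v; split=> [q Iq|].
  apply/eqP/negP => /negP qv0; apply: (avJ 0%N); rewrite expr0.
  have -> : 1 = (q.@[v]^-1)%:MP * q + (- (q.@[v]^-1)%:MP) * (q - q.@[v]%:MP).
    have: (q.@[v]^-1)%:MP * (q.@[v])%:MP = 1 :> {mpoly C[m]}.
      by rewrite -mpolyCM mulVf.
    by move=> E; rewrite mulrBr !mulNr opprK addrA subrr add0r E.
  by apply: JD; apply: JM => //; apply: IJ.
apply/negP => /eqP hv0; apply: (avJ 1%N).
by have := Jev h; rewrite hv0 mpolyC0 subr0.
Qed.

End Nullstellensatz.

(** * Matrices in block form *)

Lemma conform_mx_cast (C : nmodType) m n (e : m = n) (A : 'M[C]_m) :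
  conform_mx (0 : 'M_n) A = castmx (e, e) A.
Proof. by case: n / e; rewrite conform_mx_id castmx_id. Qed.

Lemma det_castmx (C : comNzRingType) m n (e : m = n) (A : 'M[C]_m) :
  \det (castmx (e, e) A) = \det A.
Proof. by case: n / e; rewrite castmx_id. Qed.

Section Blocks.
Variables (C : fieldType) (n k : nat) (hk : (k <= n)%N).

(** Blocks are read off as submatrices along [lo] and [hi], which confines the casts between
    [k + (n - k)] and [n] to this section. *)
Definition lo (i : 'I_k) : 'I_n := widen_ord hk i.
Definition hi (j : 'I_(n - k)) : 'I_n := cast_ord (subnKC hk) (rshift k j).

Lemma lo_hiP (i : 'I_n) : (exists i', i = lo i') \/ (exists j, i = hi j).
Proof.
have [lt|ge] := ltnP i k; first by left; exists (Ordinal lt); apply: val_inj.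
have lt : (i - k < n - k)%N by rewrite ltn_sub2r // (leq_ltn_trans ge).
by right; exists (Ordinal lt); apply: val_inj; rewrite /= subnKC.
Qed.

Lemma sum_lo_hi (V : nmodType) (F : 'I_n -> V) :
  \sum_i F i = \sum_i F (lo i) + \sum_j F (hi j).
Proof.
rewrite (reindex (cast_ord (subnKC hk))) /=; last first.
  exists (cast_ord (esym (subnKC hk))) => i _;
  by [rewrite cast_ordK|rewrite cast_ordKV].
rewrite big_split_ord; congr (_ + _); apply: eq_bigr => i _; congr (F _).
exact: val_inj.
Qed.

Lemma mxsub_mul_lo_hi m1 m2 q1 q2 (f : 'I_q1 -> 'I_m1) (g : 'I_q2 -> 'I_m2)
    (A : 'M[C]_(m1, n)) (B : 'M[C]_(n, m2)) :
  mxsub f g (A *m B) =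
  mxsub f lo A *m mxsub lo g B + mxsub f hi A *m mxsub hi g B.
Proof.
apply/matrixP => i j; rewrite !mxE sum_lo_hi.
by congr (_ + _); apply: eq_bigr => l _; rewrite !mxE.
Qed.

Lemma matrix_lo_hiP m (A B : 'M[C]_(n, m)) :
  rowsub lo A = rowsub lo B -> rowsub hi A = rowsub hi B -> A = B.
Proof.
move=> E1 E2; apply/matrixP => i j.
case: (lo_hiP i) => [] [i' ->].
  by have /matrixP/(_ i' j) := E1; rewrite !mxE.
by have /matrixP/(_ i' j) := E2; rewrite !mxE.
Qed.

Lemma blockn_cast a b c d : @blockn C n k a b c d =
  castmx (subnKC hk, subnKC hk) (block_mx a b c d).
Proof.
exact: conform_mx_cast.
Qed.

Let uncast_lo i : cast_ord (esym (subnKC hk)) (lo i) = lshift (n - k) i.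
Proof. exact: val_inj. Qed.

Let uncast_hi i : cast_ord (esym (subnKC hk)) (hi i) = rshift k i.
Proof. exact: val_inj. Qed.

Lemma blockn_ul a b c d : mxsub lo lo (@blockn C n k a b c d) = a.
Proof.
apply/matrixP => i j.
by rewrite blockn_cast !mxE castmxE !uncast_lo block_mxEul.
Qed.

Lemma blockn_ur a b c d : mxsub lo hi (@blockn C n k a b c d) = b.
Proof.
apply/matrixP => i j.
by rewrite blockn_cast !mxE castmxE uncast_lo uncast_hi block_mxEur.
Qed.

Lemma blockn_dl a b c d : mxsub hi lo (@blockn C n k a b c d) = c.
Proof.
apply/matrixP => i j.
by rewrite blockn_cast !mxE castmxE uncast_lo uncast_hi block_mxEdl.
Qed.

Lemma blockn_dr a b c d : mxsub hi hi (@blockn C n k a b c d) = d.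
Proof.
apply/matrixP => i j.
by rewrite blockn_cast !mxE castmxE !uncast_hi block_mxEdr.
Qed.

Lemma blocknK (A : 'M[C]_n) :
  blockn (mxsub lo lo A) (mxsub lo hi A) (mxsub hi lo A) (mxsub hi hi A) = A.
Proof.
apply: matrix_lo_hiP; apply/matrixP => i j; rewrite 2!mxE;
  case: (lo_hiP j) => [] [j' ->].
- by have /matrixP/(_ i j') :=
    blockn_ul (mxsub lo lo A) (mxsub lo hi A) (mxsub hi lo A) (mxsub hi hi A);
  rewrite !mxE.
- by have /matrixP/(_ i j') :=
    blockn_ur (mxsub lo lo A) (mxsub lo hi A) (mxsub hi lo A) (mxsub hi hi A);
  rewrite !mxE.
- by have /matrixP/(_ i j') :=
    blockn_dl (mxsub lo lo A) (mxsub lo hi A) (mxsub hi lo A) (mxsub hi hi A);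
  rewrite !mxE.
- by have /matrixP/(_ i j') :=
    blockn_dr (mxsub lo lo A) (mxsub lo hi A) (mxsub hi lo A) (mxsub hi hi A);
  rewrite !mxE.
Qed.

Lemma blockn_mul a b c d a' b' c' d' :
  @blockn C n k a b c d *m blockn a' b' c' d' =
  blockn (a *m a' + b *m c') (a *m b' + b *m d')
         (c *m a' + d *m c') (c *m b' + d *m d').
Proof.
rewrite -[LHS]blocknK !mxsub_mul_lo_hi !blockn_ul !blockn_ur !blockn_dl.
by rewrite !blockn_dr.
Qed.

Lemma blockn1 : @blockn C n k 1%:M 0 0 1%:M = 1%:M.
Proof.
rewrite -[RHS]blocknK; congr blockn; apply/matrixP => i j; rewrite !mxE //.
- suff -> : (lo i == hi j) = false by [].
  by apply/negbTE; rewrite -val_eqE /= neq_ltn ltn_addr.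
- suff -> : (hi i == lo j) = false by [].
  by apply/negbTE; rewrite -val_eqE /= neq_ltn ltn_addr ?orbT.
- by rewrite -[in RHS]val_eqE /= eqn_add2l.
Qed.

Lemma det_blockn a b d : \det (@blockn C n k a b 0 d) = \det a * \det d.
Proof.
by rewrite blockn_cast det_castmx det_ublock.
Qed.

Lemma det_blocknl a c d : \det (@blockn C n k a 0 c d) = \det a * \det d.
Proof.
by rewrite blockn_cast det_castmx det_lblock.
Qed.

End Blocks.

(** * Regular functions *)

Section Subalgebras.
Variables (C : fieldType).

(** One closure argument covers regular functions on SL(n), polynomial functions of a single
    parameter and polynomial functions on an affine chart; [regular_comp] pulls regular functions
    back to any of them. *)
Definition subalg T (S : set (T -> C)) := [/\ forall c, S (fun=> c),
  forall f g, S f -> S g -> S (fun t => f t + g t)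
  & forall f g, S f -> S g -> S (fun t => f t * g t)].

Lemma subalg_sum T S I (l : seq I) (P : pred I) (F : I -> T -> C) : subalg S ->
  (forall i, P i -> S (F i)) -> S (fun t => \sum_(i <- l | P i) F i t).
Proof.
move=> [SC SD _] SF; elim: l => [|i l IH].
  by under eq_fun do rewrite big_nil.
have [Pi|nPi] := boolP (P i); last by under eq_fun do rewrite big_cons (negbTE nPi).
by under eq_fun do rewrite big_cons Pi; apply: SD => //; apply: SF.
Qed.

Lemma subalg_prod T S I (l : seq I) (P : pred I) (F : I -> T -> C) : subalg S ->
  (forall i, P i -> S (F i)) -> S (fun t => \prod_(i <- l | P i) F i t).
Proof.
move=> [SC _ SM] SF; elim: l => [|i l IH].
  by under eq_fun do rewrite big_nil.
have [Pi|nPi] := boolP (P i); last by under eq_fun do rewrite big_cons (negbTE nPi).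
by under eq_fun do rewrite big_cons Pi; apply: SM => //; apply: SF.
Qed.

Lemma subalg_meval T S m (v : 'I_m -> T -> C) (q : {mpoly C[m]}) : subalg S ->
  (forall i, S (v i)) -> S (fun t => q.@[fun i => v i t]).
Proof.
move=> [SC SD SM] Sv.
elim/mpoly_ring_ind: q => [c|i|q q' IH IH'|q q' IH IH'].
- by under eq_fun do rewrite mevalC.
- by under eq_fun do rewrite mevalXU.
- by under eq_fun do rewrite mevalD; apply: SD.
- by under eq_fun do rewrite mevalM; apply: SM.
Qed.

Lemma subalg_det T S m (A : T -> 'M[C]_m) : subalg S ->
  (forall i j, S (fun t => A t i j)) -> S (fun t => \det (A t)).
Proof.
move=> sS SA; have [SC _ SM] := sS; apply: subalg_sum => // s _.
by apply: SM => //; apply: subalg_prod.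
Qed.

Lemma subalg_mul T S m1 m2 m3 (A : T -> 'M[C]_(m1, m2)) (B : T -> 'M_(m2, m3)) :
  subalg S -> (forall i j, S (fun t => A t i j)) ->
  (forall i j, S (fun t => B t i j)) -> forall i j, S (fun t => (A t *m B t) i j).
Proof.
move=> sS SA SB i j; have [_ _ SM] := sS.
by under eq_fun do rewrite mxE; apply: subalg_sum => // l _; apply: SM.
Qed.

Variable n : nat.

Lemma subalg_regular : subalg (@regular_fun C n).
Proof.
split=> [c|_ _ [q ->] [q' ->]|_ _ [q ->] [q' ->]].
- by exists c%:MP; apply/funext => g; rewrite mevalC.
- by exists (q + q'); apply/funext => g; rewrite mevalD.
- by exists (q * q'); apply/funext => g; rewrite mevalM.
Qed.

Lemma regular_entry i j : @regular_fun C n (fun g => (g : 'M_n) i j).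
Proof.
exists 'X_(mxvec_index i j); apply/funext => g.
by rewrite mevalXU mxvecE.
Qed.

Lemma regular_comp T S (G : T -> SL C n) f : subalg S -> regular_fun f ->
  (forall i j, S (fun t => (G t : 'M_n) i j)) -> S (fun t => f (G t)).
Proof.
move=> sS [q ->] SG; apply: (subalg_meval (v := fun i t => mxvec (G t) 0 i)) => // l.
by case/mxvec_indexP: l => i j; under eq_fun do rewrite mxvecE.
Qed.

Lemma subalg_horner : subalg [set f : C -> C | exists q : {poly C}, f = horner q].
Proof.
split=> [c|_ _ [q ->] [q' ->]|_ _ [q ->] [q' ->]].
- by exists c%:P; apply/funext => g; rewrite hornerC.
- by exists (q + q'); apply/funext => g; rewrite hornerD.
- by exists (q * q'); apply/funext => g; rewrite hornerM.
Qed.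

Lemma subalg_mpoly m :
  subalg [set f : ('I_m -> C) -> C | exists q : {mpoly C[m]}, f = (fun v => q.@[v])].
Proof.
split=> [c|_ _ [q ->] [q' ->]|_ _ [q ->] [q' ->]].
- by exists c%:MP; apply/funext => v; rewrite mevalC.
- by exists (q + q'); apply/funext => v; rewrite mevalD.
- by exists (q * q'); apply/funext => v; rewrite mevalM.
Qed.

End Subalgebras.

(** * Invariant sections and Plücker coordinates *)

Section Sections.
Variables (C : numClosedFieldType) (n r s : nat).
Hypotheses (hr : (r < n)%N) (hs : (s < n)%N).
Notation fn := (SL C n -> C).
Implicit Types (g h u : SL C n) (f : {ffun 'I_r -> 'I_n}) (F : fn).

(** Membership of [u] in P, together with the value [c] of the character varpi_r at [u]. *)
Definition parabolic u (c : C) := exists a b d,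
  (u : 'M_n) = @blockn C n r a b 0 d /\ \det a = c.

Lemma section_parabolic d F g u c : sections r d F -> parabolic u c ->
  F (g * u)%g = c ^+ d * F g.
Proof. by move=> [_ FP] [a [b [e [uE <-]]]]; apply: FP uE. Qed.

Lemma parabolic_neq0 u c : parabolic u c -> c != 0.
Proof.
move=> [a [b [d [uE <-]]]]; apply/eqP => a0.
have := eqP (SL_det u); rewrite uE (det_blockn (ltnW hr)) a0 mul0r.
by move/esym/eqP; rewrite oner_eq0.
Qed.

Definition pl f : fn := fun g => \det (mxsub f (lo (ltnW hr)) (g : 'M_n)).

Lemma plE f g : pl f g = \det (mxsub f (lo (ltnW hr)) (g : 'M_n)).
Proof. by []. Qed.

Lemma regular_pl f : regular_fun (pl f).
Proof.
apply: subalg_det; first exact: subalg_regular.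
move=> i j; under eq_fun do rewrite mxE; exact: regular_entry.
Qed.

Lemma section_pl f : sections r 1 (pl f).
Proof.
split; first exact: regular_pl.
move=> g u a b d uE; rewrite /pl /= uE (mxsub_mul_lo_hi (ltnW hr)).
by rewrite blockn_ul blockn_dl mulmx0 addr0 det_mulmx mulrC expr1.
Qed.

Lemma pl_noninj f : ~ injective f -> pl f = 0.
Proof.
move=> /existsNP[i /existsNP[j /not_implyP[fij /eqP ij]]].
by apply/funext => g; apply: (determinant_alternate ij) => k; rewrite !mxE fij.
Qed.

Lemma exists_pl g : exists f, pl f g != 0.
Proof.
pose A := colsub (lo (ltnW hr)) (g : 'M_n).
have fA : row_full A.
  apply/row_fullP; exists (rowsub (lo (ltnW hr)) (invmx g)).
  rewrite -mxsub_mul mulVmx ?SL_unitmx //.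
  by apply/matrixP => i j; rewrite !mxE -val_eqE.
have := fullrowsub_unit fA; rewrite unitmxE unitfE => det0.
exists (fullrankfun fA); rewrite /pl.
suff -> : mxsub (fullrankfun fA) (lo (ltnW hr)) (g : 'M_n) =
          rowsub (fullrankfun fA) A by [].
by apply/matrixP => i j; rewrite !mxE.
Qed.

Definition lam (t : C) (i : 'I_n) := if (i < s)%N then t ^+ (n - s) else t ^- s.

Lemma lambda_mulE t m (A : 'M[C]_(n, m)) i j :
  (lambda n s t *m A) i j = lam t i * A i j.
Proof. by rewrite /lambda mul_diag_mx !mxE. Qed.

(** A row below [s] contributes the exponent [n - s] of lambda and any other row [-s]. With [m] rows
    below [s] the total is [n * m - r * s], the origin of all comparisons of [n * k] with
    [r * s]. *)
Definition wt f : int := \sum_i ((n * (f i < s))%N%:Z - s%:Z).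

Lemma lamE t i : t != 0 -> lam t i = t ^ ((n * (i < s))%N%:Z - s%:Z).
Proof.
move=> t0; rewrite /lam; case: ifP => _.
  by rewrite muln1 subzn ?(ltnW hs).
by rewrite muln0 sub0r -exprnN.
Qed.

Lemma prod_lam f t : t != 0 -> \prod_i lam t (f i) = t ^ wt f.
Proof.
move=> t0; rewrite /wt; under eq_bigr do rewrite lamE //.
by apply: (big_ind2 (fun x y => x = t ^ y)) => // x1 y1 x2 y2 -> ->; rewrite expfzDr.
Qed.

Lemma pl_lambda f u t g : t != 0 -> (u : 'M_n) = lambda n s t ->
  pl f (u * g)%g = t ^ wt f * pl f g.
Proof.
move=> t0 uE; rewrite /pl /= uE.
have -> : mxsub f (lo (ltnW hr)) (lambda n s t *m g) =
  diag_mx (\row_i lam t (f i)) *m mxsub f (lo (ltnW hr)) (g : 'M_n).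
  by apply/matrixP => i j; rewrite mul_diag_mx !mxE -lambda_mulE mxE.
rewrite det_mulmx det_diag; congr (_ * _); rewrite -prod_lam //.
by apply: eq_bigr => i _; rewrite mxE.
Qed.

Definition mon (w : seq {ffun 'I_r -> 'I_n}) : fn := fun g => \prod_(f <- w) pl f g.

Lemma monE w g : mon w g = \prod_(f <- w) pl f g. Proof. by []. Qed.

Lemma mon_cat w w' g : mon (w ++ w') g = mon w g * mon w' g.
Proof. by rewrite /mon big_cat. Qed.

Lemma regular_mon w : regular_fun (mon w).
Proof. by apply: subalg_prod => [|f _]; [exact: subalg_regular|exact: regular_pl]. Qed.

Lemma section_mon w : sections r (size w) (mon w).
Proof.
split; first exact: regular_mon.
move=> g u a b d uE; rewrite /mon; elim: w => [|f w IH].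
  by rewrite !big_nil expr0 mulr1.
have [_ fP] := section_pl f.
by rewrite !big_cons IH (fP _ _ _ _ _ uE) expr1 mulrACA -exprS.
Qed.

Definition wtm w : int := \sum_(f <- w) wt f.

Lemma mon_lambda w u t g : t != 0 -> (u : 'M_n) = lambda n s t ->
  mon w (u * g)%g = t ^ wtm w * mon w g.
Proof.
move=> t0 uE; rewrite /mon /wtm; elim: w => [|f w IH].
  by rewrite !big_nil expr0z mulr1.
by rewrite !big_cons IH (pl_lambda _ _ t0 uE) expfzDr // mulrACA.
Qed.

Notation R := (@inv_sections C n r s).

Lemma inv_mon w : wtm w = 0 -> R (size w) (mon w).
Proof.
move=> w0; split; first exact: section_mon.
by move=> u g [t t0 uE]; rewrite (mon_lambda _ _ t0 uE) w0 expr0z mul1r.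
Qed.

Lemma inv_sectionsM d e (F G : fn) : R d F -> R e G -> R (d + e)%N (F * G).
Proof.
move=> [[Fr Fs] Fl] [[Gr Gs] Gl]; split; [split|].
- by have [_ _] := @subalg_regular C n; apply.
- by move=> g u a b c uE; rewrite !mulrfctE (Fs _ _ _ _ _ uE)
    (Gs _ _ _ _ _ uE) exprD mulrACA.
- by move=> u g lu; rewrite !mulrfctE Fl // Gl.
Qed.

Lemma inv_sectionsC c : R 0 (fun=> c).
Proof.
split=> //; split; first by have [+ _ _] := @subalg_regular C n; apply.
by move=> *; rewrite expr0 mul1r.
Qed.

Lemma inv_sections0 d : R d 0.
Proof.
split=> //; split; first by have [SC _ _] := @subalg_regular C n; apply: SC.
by move=> *; rewrite mulr0.
Qed.

Lemma inv_sectionsB d (F G : fn) : R d F -> R d G -> R d (F - G).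
Proof.
move=> [[Fr Fs] Fl] [[Gr Gs] Gl]; split; [split|].
- have [SC SD SM] := @subalg_regular C n; apply: SD => //.
  have -> : - G = (fun g => -1 * G g) by apply/funext => g; rewrite mulN1r.
  exact: (SM (fun=> -1)).
- by move=> g u a b c uE; rewrite !(addrfctE, opprfctE) (Fs _ _ _ _ _ uE)
    (Gs _ _ _ _ _ uE) mulrBr.
- by move=> u g lu; rewrite !(addrfctE, opprfctE) Fl // Gl.
Qed.

Lemma lambda_blockn (t : C) : lambda n s t =
  @blockn C n s (t ^+ (n - s))%:M 0 0 (t ^- s)%:M.
Proof.
rewrite -[LHS](blocknK (ltnW hs)); congr blockn; apply/matrixP => i j; rewrite !mxE.
- by rewrite /= ltn_ord -val_eqE.
- suff -> : (lo (ltnW hs) i == hi (ltnW hs) j) = false by [].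
  by apply/negbTE; rewrite -val_eqE /= neq_ltn ltn_addr.
- suff -> : (hi (ltnW hs) i == lo (ltnW hs) j) = false by [].
  by apply/negbTE; rewrite -val_eqE /= neq_ltn ltn_addr ?orbT.
- by rewrite /= ltnNge leq_addr /= -val_eqE /= eqn_add2l val_eqE.
Qed.

Lemma det_lambda (t : C) : t != 0 -> \det (lambda n s t) == 1.
Proof.
move=> t0; rewrite lambda_blockn (det_blockn (ltnW hs)) !det_scalar.
by rewrite -exprVn -!exprM mulnC exprVn mulfV // expf_neq0.
Qed.

Definition lamSL (t : C) (t0 : t != 0) : SL C n := MkSL (det_lambda t0).

Lemma Hgrp_lambda h t (t0 : t != 0) : Hgrp s h ->
  (h * lamSL t0)%g = (lamSL t0 * h)%g.
Proof.
move=> [a [b [_ _ hE]]]; apply: val_inj => /=.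
rewrite hE lambda_blockn !(blockn_mul (ltnW hs)).
by rewrite !(mulmx0, mul0mx, addr0, add0r) !scalar_mxC.
Qed.

Lemma lambda_GmP u : lambda_Gm s u -> exists t (t0 : t != 0), u = lamSL t0.
Proof. by move=> [t t0 uE]; exists t, t0; apply: val_inj. Qed.

Lemma inv_lamSL d F t (t0 : t != 0) g : R d F -> F (lamSL t0 * g)%g = F g.
Proof. by move=> [_]; apply; exists t. Qed.

Lemma inv_sections_translate d F h : Hgrp s h -> R d F ->
  R d (fun g => F (h * g)%g).
Proof.
move=> hH [[Fr Fs] Fl]; split; [split|].
- apply: (regular_comp (G := fun g => (h * g)%g)) => //.
    exact: subalg_regular.
  apply: subalg_mul => [|i j|i j]; first exact: subalg_regular.
    by have [+ _ _] := @subalg_regular C n; apply.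
  exact: regular_entry.
- by move=> g u a b c uE; rewrite mulgA (Fs _ _ _ _ _ uE).
- move=> u g /lambda_GmP[t [t0 ->]].
  by rewrite mulgA Hgrp_lambda // -mulgA; apply: Fl; exists t.
Qed.

Lemma Hgrp1 : Hgrp s (1%g : SL C n).
Proof.
exists 1%:M, 1%:M; rewrite !det1; split=> //.
by rewrite (blockn1 _ (ltnW hs)).
Qed.

Lemma HgrpM h h' : Hgrp s h -> Hgrp s h' -> Hgrp s (h * h')%g.
Proof.
move=> [a [b [da db hE]]] [a' [b' [da' db' hE']]].
exists (a *m a'), (b *m b'); rewrite !det_mulmx da db da' db' !mulr1; split=> //=.
rewrite hE hE' (blockn_mul (ltnW hs)).
by rewrite !(mulmx0, mul0mx, addr0, add0r).
Qed.

Lemma HgrpV h : Hgrp s h -> Hgrp s (h^-1)%g.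
Proof.
move=> [a [b [da db hE]]].
exists (invmx a), (invmx b); rewrite !det_inv da db !invr1; split=> //=.
have ua : a \in unitmx by rewrite unitmxE da unitr1.
have ub : b \in unitmx by rewrite unitmxE db unitr1.
apply: (row_free_inj (A := (h : 'M_n))).
  by rewrite row_free_unit SL_unitmx.
rewrite mulVmx ?SL_unitmx // hE (blockn_mul (ltnW hs)).
by rewrite !(mulmx0, mul0mx, addr0, add0r) !mulVmx // (blockn1 _ (ltnW hs)).
Qed.

End Sections.

(** * Points of Proj *)

Section AdditiveClosure.
Variables (A : pzRingType).
Implicit Types (G : set A) (F : A).

(** The generating sets used below already absorb scalars, so finite sums without coefficients
    suffice. *)
Inductive addcl G : A -> Prop :=
| addcl0 : addcl G 0
| addclS F F' : G F -> addcl G F' -> addcl G (F + F').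

Lemma addcl_gen G F : G F -> addcl G F.
Proof. by move=> GF; rewrite -[F]addr0; apply: addclS => //; apply: addcl0. Qed.

Lemma addcl_zero G F : F = 0 -> addcl G F.
Proof. by move=> ->; apply: addcl0. Qed.

Lemma addclD G F F' : addcl G F -> addcl G F' -> addcl G (F + F').
Proof.
move=> GF GF'; elim: GF => [|F1 F2 G1 _ IH]; first by rewrite add0r.
by rewrite -addrA; apply: addclS.
Qed.

Lemma addcl_sub G G' F : (forall F', G F' -> addcl G' F') -> addcl G F -> addcl G' F.
Proof.
move=> GG'; elim=> [|F1 F2 G1 _ IH]; first exact: addcl0.
by apply: addclD => //; apply: GG'.
Qed.

Lemma addcl_mul G G' G'' F F' :
  (forall F F', G F -> G' F' -> G'' (F * F')) ->
  addcl G F -> addcl G' F' -> addcl G'' (F * F').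
Proof.
move=> GG' GF GF'; elim: GF => [|F1 F2 G1 _ IH]; first by rewrite mul0r; apply: addcl0.
rewrite mulrDl; apply: addclD => // {IH F2}.
elim: GF' => [|F2 F3 G2 _ IH]; first by rewrite mulr0; apply: addcl0.
by rewrite mulrDr; apply: addclS => //; apply: GG'.
Qed.

End AdditiveClosure.

Section Existence.
Variables (C : numClosedFieldType) (n r : nat) (hr : (r < n)%N).
Notation fn := (SL C n -> C).
Notation word := (seq {ffun 'I_r -> 'I_n}).
Notation mon := (@mon C n r hr).
Notation pl := (@pl C n r hr).
Notation loR := (lo (ltnW hr)).
Notation hiR := (hi (ltnW hr)).
Implicit Types (g h u : SL C n) (f : {ffun 'I_r -> 'I_n}) (F : fn) (w : word).

(** The degree-[e] part of the algebra generated by the Plücker coordinates. *)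
Definition Pl e : set fn :=
  addcl [set F | exists c w, size w = e /\ F = (fun=> c) * mon w].

Lemma PlM e e' F F' : Pl e F -> Pl e' F' -> Pl (e + e') (F * F').
Proof.
apply: addcl_mul => _ _ [c [w [<- ->]]] [c' [w' [<- ->]]].
exists (c * c'), (w ++ w'); rewrite size_cat; split=> //.
by apply/funext => g; rewrite !mulrfctE mon_cat mulrACA.
Qed.

Lemma Pl_mon w c : Pl (size w) ((fun=> c) * mon w).
Proof. by apply: addcl_gen; exists c, w. Qed.

Lemma mon_nseq N f g : mon (nseq N f) g = pl f g ^+ N.
Proof. by rewrite /mon big_nseq -Monoid.iteropE. Qed.

Lemma Pl_sum e I (l : seq I) (F : I -> fn) :
  (forall i, Pl e (F i)) -> Pl e (\sum_(i <- l) F i).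
Proof. by move=> PF; elim/big_ind: _ => //; [exact: addcl0|exact: addclD]. Qed.

(** ** Affine charts of the Grassmannian *)

(** Left multiplication by [k] brings the rows chosen by [f] to the top, hence carries the chart
    [pl f != 0] to the standard chart around the base point. *)
Lemma exists_SL_rows f : injective f ->
  exists k : SL C n, rowsub loR (k : 'M_n) = rowsub f 1%:M.
Proof.
move=> finj; pose U : 'M[C]_(r, n) := rowsub loR 1%:M.
pose V : 'M[C]_(r, n) := rowsub f 1%:M.
have orth (m : 'I_r -> 'I_n) : injective m ->
    rowsub m (1%:M : 'M[C]_n) *m (rowsub m 1%:M)^T = 1%:M.
  move=> minj; rewrite mul_rowsub_mx mul1mx; apply/matrixP => i j.
  by rewrite !mxE (inj_eq minj) eq_sym.
have rk (m : 'I_r -> 'I_n) : injective m ->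
    \rank (rowsub m (1%:M : 'M[C]_n)) = r.
  move=> /orth E; apply/eqP; rewrite eqn_leq rank_leq_row /=.
  by rewrite -[leqLHS](mxrank1 C) -E mxrankM_maxl.
have loinj : injective loR by move=> i j /(congr1 val) /= /val_inj.
have UV : U *m (U^T *m V) = V by rewrite mulmxA orth // mul1mx.
have [k uk kE] : {k : 'M[C]_n | k \in unitmx & U *m (U^T *m V) = U *m k}.
  by apply: complete_unitmx; rewrite UV !rk.
have lt_n : (n.-1 < n)%N by lia.
(* The determinant is corrected in the last row, which is not among the first [r] because
   [r < n]. *)
pose i0 := Ordinal lt_n; pose D := diag_mx (\row_i if i == i0 then (\det k)^-1 else 1).
have detD : \det D = (\det k)^-1.
  rewrite det_diag (bigD1 i0) //= mxE eqxx big1 ?mulr1 // => i /negbTE ii0.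
  by rewrite mxE ii0.
have detDk : \det (D *m k) == 1.
  by rewrite det_mulmx detD mulVr // -unitmxE.
exists (MkSL detDk) => /=; rewrite -/V -UV kE /U mul_rowsub_mx mul1mx.
apply/matrixP => i j; rewrite mxE mul_diag_mx !mxE.
suff -> : (loR i == i0) = false by rewrite mul1r.
by apply/negbTE; rewrite -val_eqE /= neq_ltn; have := ltn_ord i; lia.
Qed.

(** The unipotent radical of the parabolic opposite to P, which parametrises the standard affine
    chart of G/P. *)
Definition unip (Y : 'M[C]_(n - r, r)) : 'M[C]_n := blockn 1%:M 0 Y 1%:M.

Fact unip_det Y : \det (unip Y) == 1.
Proof. by rewrite /unip (det_blocknl (ltnW hr)) !det1 mulr1. Qed.

Definition unipSL Y : SL C n := MkSL (unip_det Y).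

Lemma unip_entry i j : (exists c, forall Y, unip Y i j = c) \/
  (exists i' j', forall Y, unip Y i j = Y i' j').
Proof.
case: (lo_hiP (ltnW hr) i) => [] [i' ->]; case: (lo_hiP (ltnW hr) j) => [] [j' ->].
- left; exists ((i' == j')%:R) => Y.
  have /matrixP/(_ i' j') := blockn_ul (ltnW hr) 1%:M 0 Y 1%:M.
  by rewrite !mxE.
- left; exists 0 => Y.
  have /matrixP/(_ i' j') := blockn_ur (ltnW hr) 1%:M 0 Y 1%:M.
  by rewrite !mxE.
- right; exists i', j' => Y.
  have /matrixP/(_ i' j') := blockn_dl (ltnW hr) 1%:M 0 Y 1%:M.
  by rewrite !mxE.
- left; exists ((i' == j')%:R) => Y.
  have /matrixP/(_ i' j') := blockn_dr (ltnW hr) 1%:M 0 Y 1%:M.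
  by rewrite !mxE.
Qed.

Section Chart.
Variables (f : {ffun 'I_r -> 'I_n}) (k : SL C n).
Hypothesis kf : rowsub loR (k : 'M_n) = rowsub f 1%:M.

Definition chart Y : SL C n := (k^-1 * unipSL Y)%g.

(* where [pl f g = 0] this is the junk value 0 *)
Definition coordY g : 'M[C]_(n - r, r) :=
  (pl f g)^-1 *: (mxsub hiR loR (k * g)%g *m \adj (mxsub f loR (g : 'M_n))).

Lemma chart_ul g : mxsub loR loR (k * g)%g = mxsub f loR (g : 'M_n).
Proof. by rewrite /= mxsub_mul kf -mxsub_mul mul1mx. Qed.

Lemma chartE g : pl f g != 0 ->
  exists u, parabolic r u (pl f g) /\ g = (chart (coordY g) * u)%g.
Proof.
move=> g0; exists ((chart (coordY g))^-1 * g)%g; split; last by rewrite mulVKg.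
pose a := mxsub f loR (g : 'M_n).
have E : (unipSL (coordY g))^-1%g = unipSL (- coordY g).
  apply/esym/eqP; rewrite eq_sym -(can_eq (mulgK (unipSL (coordY g)))) mulVg.
  apply/eqP/val_inj; rewrite /= /unip (blockn_mul (ltnW hr)).
  by rewrite !(mulmx0, mul0mx, mul1mx, mulmx1, addr0, add0r) addNr (blockn1 _
      (ltnW hr)).
rewrite /chart invgM invgK E -mulgA.
exists a, (mxsub loR hiR (k * g)%g),
  (mxsub hiR hiR (k * g)%g - coordY g *m mxsub loR hiR (k * g)%g); split=> //.
rewrite [LHS]/= -[k *m g](blocknK (ltnW hr)) (blockn_mul (ltnW hr)).
rewrite !(mul0mx, mul1mx, addr0).
rewrite chart_ul mulNmx mulNmx [X in blockn _ _ _ X]addrC.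
suff -> : coordY g *m mxsub f loR (g : 'M_n) = mxsub hiR loR (k * g)%g.
  by rewrite addNr.
rewrite /coordY -scalemxAl -mulmxA mul_adj_mx -/(pl f g).
by rewrite mul_mx_scalar scalerA mulVf // scale1r.
Qed.

Lemma section_chart d F g : sections r d F -> pl f g != 0 ->
  F g = pl f g ^+ d * F (chart (coordY g)).
Proof.
by move=> Fs /chartE[u [pu E]]; rewrite [in LHS]E (section_parabolic _ Fs pu).
Qed.

(** By Laplace expansion this entry is the minor [pl f] with its [j]-th row replaced by a row of
    [k * g]. That row is a combination of the rows of [g], so the minor is a combination of Plücker
    coordinates. *)
Lemma Pl_coord i j : Pl 1
  (fun g => (mxsub hiR loR (k * g)%g *m \adj (mxsub f loR (g : 'M_n))) i j).
Proof.
pose fb b : {ffun 'I_r -> 'I_n} := [ffun j' => if j' == j then b else f j'].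
have -> : (fun g => (mxsub hiR loR (k * g)%g *m \adj (mxsub f loR (g : 'M_n))) i j) =
    \sum_b ((fun=> (k : 'M_n) (hiR i) b) * mon [:: fb b] : fn).
  apply/funext => g; rewrite fct_sumE mxE.
  under eq_bigr do rewrite mxE [(k * g)%g _ _]mxE mulr_suml.
  rewrite exchange_big /=; apply: eq_bigr => b _.
  rewrite !mulrfctE monE big_seq1.
  under eq_bigr do rewrite -mulrA.
  rewrite -mulr_sumr; congr (_ * _).
  rewrite !plE (expand_det_row _ j); apply: eq_bigr => l _.
  rewrite !mxE ffunE eqxx; congr (_ * _); rewrite /cofactor; congr (_ * \det _).
  apply/matrixP => i' j'; rewrite !mxE ffunE.
  by rewrite eq_sym (negbTE (neq_lift _ _)).
by apply: Pl_sum => b; apply: (Pl_mon [:: _]).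
Qed.

Lemma Pl_chart (q : {mpoly C[(n - r) * r]}) : exists D0, forall D, (D0 <= D)%N ->
  Pl D (fun g => pl f g ^+ D * q.@[mxvec (coordY g) 0]).
Proof.
elim/mpoly_ring_ind: q => [c|l|q q' [D1 IH1] [D2 IH2]|q q' [D1 IH1] [D2 IH2]].
- exists 0%N => D _; rewrite -[D in Pl D](size_nseq D f).
  rewrite (_ : (fun g => _) = (fun=> c) * mon (nseq D f)); first exact: Pl_mon.
  by apply/funext => g; rewrite mulrfctE mon_nseq mevalC mulrC.
(* The bound is 2 and not 1: where [pl f g = 0] the coordinates are 0 while their numerators need
   not be, so a factor [pl f] must be left over to kill them. *)
- exists 2%N => D D2; case/mxvec_indexP: l => i j.
  have -> : D = (size (nseq D.-1 f) + 1)%N by rewrite size_nseq; lia.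
  rewrite (_ : (fun g => _) = ((fun=> 1) * mon (nseq D.-1 f)) * (fun g =>
    (mxsub hiR loR (k * g)%g *m \adj (mxsub f loR (g : 'M_n))) i j)).
    by apply: PlM; [exact: Pl_mon|exact: Pl_coord].
  apply/funext => g; rewrite !mulrfctE mon_nseq mevalXU mxvecE [coordY _ _ _]mxE.
  rewrite size_nseq mul1r.
  have [->|g0] := eqVneq (pl f g) 0; first by rewrite !expr0n;
      case: D D2 => [|[]] //= *; rewrite !mul0r.
  by rewrite mulrA addn1 exprSr mulfK.
- exists (maxn D1 D2) => D; rewrite geq_max => /andP[l1 l2].
  rewrite (_ : (fun g => _) = (fun g => pl f g ^+ D * q.@[mxvec (coordY g) 0]) +
    (fun g => pl f g ^+ D * q'.@[mxvec (coordY g) 0])).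
    by apply: addclD; [apply: IH1|apply: IH2].
  by apply/funext => g; rewrite addrfctE mevalD mulrDr.
- exists (D1 + D2)%N => D l.
  have -> : D = (D1 + (D - D1))%N by lia.
  rewrite (_ : (fun g => _) = (fun g => pl f g ^+ D1 * q.@[mxvec (coordY g) 0]) *
    (fun g => pl f g ^+ (D - D1) * q'.@[mxvec (coordY g) 0])).
    by apply: PlM; [apply: IH1|apply: IH2; lia].
  by apply/funext => g; rewrite mulrfctE mevalM exprD mulrACA.
Qed.

Lemma chart_poly F : regular_fun F -> exists q : {mpoly C[(n - r) * r]},
  forall Y, q.@[mxvec Y 0] = F (chart Y).
Proof.
move=> Fr.
have : [set F : ('I_((n - r) * r) -> C) ->
    C | exists q : {mpoly C[_]}, F = (fun v => q.@[v])]
  (fun v => F (chart (vec_mx (\row_l v l)))).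
  apply: (regular_comp (G := fun v => chart (vec_mx (\row_l v l)))) => //.
    exact: subalg_mpoly.
  have sa := @subalg_mpoly C ((n - r) * r); have [SC _ _] := sa.
  apply: subalg_mul => // i j.
  have [[c cE]|[i' [j' E]]] := unip_entry i j.
    by exists c%:MP; apply/funext => v; rewrite mevalC; exact: cE.
  exists 'X_(mxvec_index i' j'); apply/funext => v.
  by rewrite mevalXU; apply: etrans (E _) _; rewrite !mxE.
move=> [q qE]; exists q => Y; rewrite -[LHS](congr1 (@^~ _) qE); congr (F (chart _)).
by apply/matrixP => i j; rewrite !mxE mxvecE.
Qed.

End Chart.

End Existence.

(** * Homogeneous primes of invariants and the ideals they generate over the Plücker coordinates *)

Section Existence2.
Variables (C : numClosedFieldType) (n r s : nat).
Hypotheses (hr : (r < n)%N) (hs : (s < n)%N).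
Notation fn := (SL C n -> C).
Notation R := (@inv_sections C n r s).
Notation word := (seq {ffun 'I_r -> 'I_n}).
Notation mon := (@mon C n r hr).
Implicit Types (g h u : SL C n) (f : {ffun 'I_r -> 'I_n}) (F : fn) (w : word).

Variable x : nat -> set fn.
Hypothesis px : homog_prime R x.

Lemma prime_sub d F : x d F -> R d F.
Proof. by case: px => -[sub _ _ _] _ _; apply: sub. Qed.

Lemma prime0 d : x d 0. Proof. by case: px => -[]. Qed.

Lemma prime_mull d e F G : R d F -> x e G -> x (d + e)%N (F * G).
Proof. by case: px => -[_ _ _ +] _ _; apply. Qed.

Lemma prime_scale d c F : x d F -> x d ((fun=> c) * F).
Proof. by move=> xF; apply: (@prime_mull 0%N) => //; apply: inv_sectionsC. Qed.

Lemma primeD d F G : x d F -> x d G -> x d (F + G).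
Proof.
move=> xF xG; case: px => -[_ _ xB _] _ _.
have -> : F + G = F - (0 - G) by rewrite sub0r opprK.
by apply: (xB) => //; apply: (xB) => //; apply: prime0.
Qed.

Lemma prime_sum d I (l : seq I) (P : pred I) (F : I -> fn) :
  (forall i, P i -> x d (F i)) -> x d (\sum_(i <- l | P i) F i).
Proof. by move=> xF; elim/big_ind: _ => //; [exact: prime0|exact: primeD]. Qed.

Lemma R_exp d F M : R d F -> R (M * d)%N (F ^+ M).
Proof.
move=> RF; elim: M => [|M IH]; first exact: inv_sectionsC.
by rewrite exprS mulSn; apply: inv_sectionsM.
Qed.

Lemma prime_exp d F M : R d F -> x (M * d)%N (F ^+ M) -> x d F.
Proof.
move=> RF; case: px => _ n1 xP; elim: M => [//|M IH].
by rewrite exprS mulSn => /(xP _ _ _ _ RF (R_exp M RF))[].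
Qed.

(* The degree-[e] part of the ideal generated by [x] in the ring generated by
   the Plücker coordinates, times the [N]-th power of the irrelevant ideal. *)
Definition J N e : set fn := addcl [set F | exists w d e' G,
  [/\ x d G, size w = (N + e')%N, (e' + d)%N = e & F = mon w * G]].

Lemma J_mulR N e d F G : J N e F -> R d G -> J N (e + d) (F * G).
Proof.
move=> JF RG; apply: (addcl_mul (G' := [set G])) JF (addcl_gen _) => //.
move=> _ _ [w [d' [e' [F' [xF sw <- ->]]]]] ->.
exists w, (d' + d)%N, e', (F' * G); split=> //; last by rewrite mulrA.
- by rewrite mulrC addnC; apply: prime_mull.
- by rewrite addnA.
Qed.

Lemma J_scale N e c F : J N e F -> J N e ((fun=> c) * F).
Proof.
by move=> JF; rewrite mulrC -[e]addn0; apply: J_mulR JF _; apply: inv_sectionsC.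
Qed.

Lemma J_mul e e' F F' : J 0 e F -> J 0 e' F' -> J 0 (e + e') (F * F').
Proof.
apply: addcl_mul => _ _ [w [d [e1 [G [xG sw <- ->]]]]]
    [w' [d' [e1' [G' [xG' sw' <- ->]]]]].
exists (w ++ w'), (d + d')%N, (e1 + e1')%N, (G * G'); split.
- by apply: prime_mull => //; apply: prime_sub.
- by rewrite size_cat sw sw'.
- by rewrite addnACA.
- by apply/funext => g; rewrite !mulrfctE mon_cat mulrACA.
Qed.

Lemma J_mon w N e F : J N e F -> J (size w + N) e (mon w * F).
Proof.
move=> JF; apply: (addcl_mul (G := [set mon w])) (addcl_gen _) JF => //.
move=> _ _ -> [w' [d [e' [G [xG sw <- ->]]]]].
exists (w ++ w'), d, e', G; split=> //; first by rewrite size_cat sw addnA.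
by apply/funext => g; rewrite !mulrfctE mon_cat mulrA.
Qed.

(** Cutting each word after its first [N] letters leaves coefficients in [J 0 e]; these become the
    entries of the matrix in the determinant trick. *)
Lemma J_decomp N e F : J N e F ->
  exists c : N.-tuple {ffun 'I_r -> 'I_n} -> fn,
    (forall w : N.-tuple _, J 0 e (c w)) /\ F = \sum_(w : N.-tuple _) c w * mon w.
Proof.
elim=> [|_ F' [w [d [e' [G [xG sw eE ->]]]]] _ [c [Jc ->]]].
  exists (fun=> 0); split=> [w|]; first exact: addcl0.
  by rewrite big1 // => w _; rewrite mul0r.
have stake : size (take N w) == N by rewrite size_takel // sw leq_addr.
pose t := Tuple stake.
exists (fun z => c z + if z == t then mon (drop N w) * G else 0).
split=> [z|].
  apply: addclD; first exact: Jc.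
  have [_|_] := eqVneq z t; last exact: addcl0.
  apply: addcl_gen; exists (drop N w), d, e', G; split=> //.
  by rewrite size_drop sw addKn.
rewrite [RHS](eq_bigr (fun z : N.-tuple _ => c z * mon z +
  (if z == t then mon (drop N w) * G else 0) * mon z)); last first.
  by move=> z _; rewrite mulrDl.
rewrite big_split /= addrC; congr (_ + _).
rewrite (bigD1 t) //= eqxx big1 ?addr0 => [|z /negbTE ->]; last by rewrite mul0r.
apply/funext => g; rewrite !mulrfctE -{1}(cat_take_drop N w) mon_cat.
by rewrite [LHS]mulrAC [LHS]mulrC mulrA [RHS]mulrAC.
Qed.

(* The weight of the generator [mon w * G] under lambda is that of [w]. *)
Lemma J_weights e F : J 0 e F -> exists k (v : nat -> int) (b : nat -> fn),
  F = \sum_(i < k) b i /\ forall i, (v i = 0 -> x e (b i)) /\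
    forall t (t0 : t != 0) g, b i (lamSL hs t0 * g)%g = t ^ v i * b i g.
Proof.
elim=> [|_ F' [w [d [e' [G [xG sw <- ->]]]]] _ [k [v [b [-> Hb]]]]].
  exists 0%N, (fun=> 0), (fun=> 0); split=> [|i]; first by rewrite big_ord0.
  by split=> [_|t t0 g]; [exact: prime0|rewrite mulr0].
exists k.+1, (fun i => if i is i'.+1 then v i' else wtm s w).
exists (fun i => if i is i'.+1 then b i' else mon w * G).
split=> [|[|i]]; [by rewrite big_ord_recl| |exact: Hb]; split=> [w0|t t0 g].
  by apply: prime_mull => //; rewrite -[e']sw; apply: inv_mon.
have [_ RG] := prime_sub xG.
have lE : (lamSL hs t0 : 'M_n) = lambda n s t by [].
rewrite !mulrfctE (mon_lambda hr hs w g t0 lE) RG ?mulrA //.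
by exists t.
Qed.

Lemma int_bound (v : nat -> int) k : exists M : nat, forall i, (i < k)%N ->
    (`|v i| <= M)%N.
Proof.
elim: k => [|k [M HM]]; first by exists 0%N.
exists (M + `|v k|)%N => i; rewrite ltnS leq_eqVlt => /predU1P[->|/HM]; lia.
Qed.

(** The values of [F] do not change under lambda, so [F] is the sum of its terms of weight 0, and
    those terms lie in [x]. *)
Lemma J_invariant e F : J 0 e F -> R e F -> x e F.
Proof.
move=> /J_weights[k [v [b [FE Hb]]]] RF.
suff -> : F = \sum_(i < k | v i == 0) b i.
  by apply: prime_sum => i /eqP /(Hb i).1.
apply/funext => g; have [M HM] := int_bound v k.
(* The shift by [M] makes all exponents nonnegative; the terms of weight 0 are then read off at
   ['X^M]. *)
pose p : {poly C} := F g *: 'X^M - \sum_(i < k) b i g *: 'X^(`|(v i + M)%R|%N).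
have pt t : t != 0 -> p.[t] = 0.
  move=> t0; rewrite /p hornerD hornerN hornerZ hornerXn horner_sum.
  rewrite -(inv_lamSL hs t0 g RF) {1}FE fct_sumE mulr_suml -sumrB big1 // => i _.
  rewrite (Hb i).2 hornerZ hornerXn mulrAC [b i g * _]mulrC -mulrBl.
  have -> : t ^+ `|(v i + M)%R|%N = t ^ (v i + M).
    rewrite exprnP gez0_abs //; have := HM i (ltn_ord i); lia.
  by rewrite expfzDr // subrr mul0r.
have p0 := poly_eq0_nonzero pt.
have /(congr1 (fun q : {poly C} => q`_M)) := p0.
rewrite coef0 coefB coefZ coefXn eqxx mulr1 coef_sum => /eqP.
rewrite subr_eq0 => /eqP ->; rewrite fct_sumE [RHS]big_mkcond /=.
apply: eq_bigr => i _; rewrite coefZ coefXn.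
have -> : (M == `|(v i + M)%R|)%N = (v i == 0) by have := HM i (ltn_ord i); lia.
by case: eqP; rewrite ?mulr1 ?mulr0.
Qed.

End Existence2.

(** * A homogeneous prime has a common zero: charts and the determinant trick *)

Section Existence3.
Variables (C : numClosedFieldType) (n r s : nat).
Hypothesis uncountableC : ~ countable [set: C].
Hypotheses (hr : (r < n)%N) (hs : (s < n)%N).
Notation fn := (SL C n -> C).
Notation R := (@inv_sections C n r s).
Notation word := (seq {ffun 'I_r -> 'I_n}).
Notation mon := (@mon C n r hr).
Notation pl := (@pl C n r hr).
Implicit Types (g h u : SL C n) (f : {ffun 'I_r -> 'I_n}) (F : fn) (w : word).

Variable x : nat -> set fn.
Hypothesis px : homog_prime R x.
Notation J := (J hr x).
Variables (d0 : nat) (sg : fn).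
Hypotheses (d0_gt0 : (0 < d0)%N) (Rsg : R d0 sg) (nxsg : ~ x d0 sg).
Hypothesis nopoint : forall g, (forall d F, x d F -> F g = 0) -> sg g = 0.

Lemma mon_coprime_part (w : word) f N : (N <= count_mem f w)%N ->
  exists w', (size w' + N = size w)%N /\ mon w = mon w' * pl f ^+ N.
Proof.
move=> leN; exists (nseq (count_mem f w - N) f ++ [seq f' <- w | f' != f]); split.
  rewrite size_cat size_nseq size_filter -(count_predC (pred1 f) w) addnAC subnK //.
apply/funext => g; rewrite mulrfctE mon_cat mon_nseq exprfctE mulrAC -exprD subnK //.
rewrite !monE big_filter [LHS](bigID (pred1 f)) /=; congr (_ * _).
rewrite (eq_bigr (fun=> pl f g)) => [|f' /eqP -> //].
by rewrite big_const_seq -Monoid.iteropE.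
Qed.

(** On the chart [pl f != 0] sections become polynomials. The ideal [I] collects those that
    homogenise to combinations of elements of [x], and it contains the restrictions of the elements
    of [x]. A zero of [I] at which [sg] does not vanish would contradict [nopoint], so [I] contains
    a power of [sg]. *)
Lemma chart_step f : exists M0, forall M, (M0 <= M)%N -> exists N0,
  forall N, (N0 <= N)%N -> J N (M * d0) (pl f ^+ N * sg ^+ M).
Proof.
have [finj|] := pselect (injective f); last first.
  move=> /(pl_noninj C hr) pl0; exists 0%N => M _; exists 1%N => -[//|N] _.
  by apply: addcl_zero; rewrite pl0 expr0n mul0r.
have [k kf] := exists_SL_rows C hr finj.
pose co g := mxvec (coordY hr f k g) 0.
pose Q b D : set fn := addcl [set F | exists w d G,
  [/\ x d G, (d <= b)%N, (size w + d)%N = D & F = mon w * G]].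
have QS b b' D F : (b <= b')%N -> Q b D F -> Q b' D F.
  move=> bb'; apply: addcl_sub => _ [w [d [G [xG db sw ->]]]]; apply: addcl_gen.
  by exists w, d, G; split=> //; apply: leq_trans bb'.
(* The bound [b] on the degrees taken from [x] must not depend on the multiplier [a]: below, [M] is
   chosen from [b] first, with [b <= M * d0], and only then is [a = qs ^+ (M - M1)] known. *)
pose I : set {mpoly C[(n - r) * r]} := [set q | exists b, forall a, exists D,
  forall D', (D <= D')%N -> Q b D' (fun g => pl f g ^+ D' * (a * q).@[co g])].
have idI : mideal I.
  split.
  - exists 0%N => a; exists 0%N => D' _; apply: addcl_zero; apply/funext => g.
    by rewrite mulr0 meval0 mulr0.
  - move=> q q' [b1 H1] [b2 H2]; exists (maxn b1 b2) => a.
    have [[D1 {}H1] [D2 {}H2]] := (H1 a, H2 a).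
    exists (maxn D1 D2) => D'; rewrite geq_max => /andP[l1 l2].
    rewrite (_ : (fun g => _) = (fun g => pl f g ^+ D' * (a * q).@[co g]) +
       (fun g => pl f g ^+ D' * (a * q').@[co g])).
      apply: addclD; first exact: QS (leq_maxl _ _) (H1 _ l1).
      exact: QS (leq_maxr _ _) (H2 _ l2).
    by apply/funext => g; rewrite addrfctE mulrDr mevalD mulrDr.
  - move=> a q [b H]; exists b => a'; have [D {}H] := H (a' * a).
    by exists D => D' /H; under eq_fun do rewrite -mulrA.
have Ix d F q : x d F -> (forall Y, q.@[mxvec Y 0] = F (chart hr k Y)) -> I q.
  move=> xF qE; exists d => a; have [D0 Pa] := Pl_chart hr f k a.
  (* The successor keeps both [D'] and [D' - d] positive, so both sides vanish where
     [pl f g = 0]. *)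
  exists (D0 + d).+1 => D' lD.
  rewrite (_ : (fun g => _) = (fun g => pl f g ^+ (D' - d) * a.@[co g]) * F).
    have: Pl hr (D' - d) (fun g => pl f g ^+ (D' - d) * a.@[co g]).
      by apply: Pa; lia.
    move=> PF; apply: (addcl_mul (G' := [set F])) PF (addcl_gen _) => //.
    move=> _ _ [c [w [sw ->]]] ->; exists w, d, ((fun=> c) * F).
    split=> //; [exact: (prime_scale px)|rewrite sw; lia|].
    by apply/funext => g; rewrite !mulrfctE [c * _]mulrC mulrA.
  apply/funext => g; rewrite mulrfctE mevalM qE.
  have [g0|g0] := eqVneq (pl f g) 0.
    by rewrite g0 !expr0n; have [-> ->] : D' == 0%N = false /\ (D' - d == 0)%N = false;
      [split; lia|rewrite !mul0r].
  rewrite (section_chart kf (prime_sub px xF).1 g0).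
  rewrite -{1}(subnK (_ : d <= D')%N); last lia.
  by rewrite exprD -!mulrA; congr (_ * _); rewrite mulrCA.
have [qs qsE] := chart_poly hr k Rsg.1.1.
have [avI|] := pselect (avoids qs I).
  have [v [Iv /eqP[]]] := nullstellensatz uncountableC idI avI.
  have vE q : q.@[v] = q.@[mxvec (vec_mx (\row_l v l) : 'M_(n - r, r)) 0].
    by apply: meval_eq => l; rewrite vec_mxK mxE.
  rewrite vE qsE; apply: nopoint => d F xF.
  have [q qE] := chart_poly hr k (prime_sub px xF).1.1.
  by rewrite -qE -vE; apply: Iv; apply: Ix xF qE.
move=> /existsNP[M1 /contrapT [b Hb]]; exists (M1 + b)%N => M leM.
have [D HD] := Hb (qs ^+ (M - M1)); exists D.+1 => N leN.
have lt_bM : (b <= M * d0)%N by rewrite (leq_trans _ (leq_pmulr M d0_gt0)) //; lia.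
(* The factor [pl f ^+ (M * d0)] turns the restriction of [sg ^+ M] to the chart back into
   [sg ^+ M], leaving [pl f ^+ N]. *)
have {HD} := HD (N + M * d0)%N ltac:(lia).
rewrite (_ : (fun g => _) = pl f ^+ N * sg ^+ M).
  apply: addcl_sub => _ [w [d [G [xG db sw ->]]]]; apply: addcl_gen.
  by exists w, d, (M * d0 - d)%N, G; split=> //; lia.
apply/funext => g; rewrite mulrfctE !exprfctE -exprD subnK; last lia.
rewrite rmorphXn /= qsE.
have [g0|g0] := eqVneq (pl f g) 0.
  by rewrite g0 !expr0n; have [-> ->] : (N + M * d0 == 0)%N = false /\
      (N == 0)%N = false;
    [split; lia|rewrite !mul0r].
rewrite (section_chart kf Rsg.1 g0) exprMn_comm; last exact: mulrC.
by rewrite -exprM exprD mulrA [(M * d0)%N]mulnC.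
Qed.

(** Since [chart_step] allows every larger exponent, one [M] and one [N1] serve all charts. By the
    pigeonhole principle a word of length [N1] times the number of letters repeats some letter [N1]
    times, and the chart of that letter applies. *)
Lemma words_step : exists M N, (0 < M)%N /\
  forall w, size w = N -> J N (M * d0) (mon w * sg ^+ M).
Proof.
have /choice[M0 HM0] := chart_step.
pose M := (\sum_f M0 f).+1.
have leM f : (M0 f <= M)%N.
  by apply/leqW; rewrite (bigD1 f) //= leq_addr.
have /choice[N0 HN0] := fun f => HM0 f M (leM f).
pose N1 := \sum_f N0 f.
have leN f : (N0 f <= N1)%N by rewrite /N1 (bigD1 f) //= leq_addr.
pose F := {ffun 'I_r -> 'I_n}.
pose f0 : F := [ffun=> Ordinal (leq_ltn_trans (leq0n r) hr)].
exists M, (#|{: F}| * N1)%N; split=> // w sw.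
have [f lef] : exists f, (N1 <= count_mem f w)%N.
  apply: contrapT => /forallNP H.
  have : (\sum_f (count_mem f w).+1 <= #|{: F}| * N1)%N.
    rewrite -sum_nat_const leq_sum // => f _.
    by rewrite ltnNge; apply/negP/H.
  under eq_bigr do rewrite -addn1.
  rewrite big_split /= sum_nat_const muln1.
  have -> : (\sum_f count_mem f w = size w)%N.
    rewrite -sum1_size; under eq_bigr do rewrite -sum1_count big_mkcond.
    rewrite exchange_big /=; apply: eq_bigr => f _.
    by rewrite (bigD1 f) //= eqxx big1 // => f' /negbTE; rewrite eq_sym => ->.
  rewrite sw -[leqRHS]addn0 leq_add2l leqn0 => /eqP E.
  by have := fintype0 f0 E.
have [w' [sw' ->]] := mon_coprime_part lef.
by rewrite -sw -sw' -mulrA; apply: J_mon => //; apply: HN0.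
Qed.

Lemma J_opp N e F : J N e F -> J N e (- F).
Proof.
have -> : - F = (fun=> -1) * F.
  by apply/funext => g; rewrite mulrfctE opprfctE mulN1r.
exact: (J_scale px).
Qed.

(** Every term of the expansion contains an entry of [c], and so lies in [J 0], except the product
    of the [D] diagonal terms [sg ^+ M]. The products are expanded by induction on the list of
    indices in order to track degrees. *)
Lemma J_det M D (c : 'I_D -> 'I_D -> fn) : (forall i j, J 0 (M * d0) (c i j)) ->
  exists F, J 0 (D * (M * d0)) F /\
    forall g, \det ((sg g ^+ M)%:M - \matrix_(i, j) c i j g) = sg g ^+ (M * D) + F g.
Proof.
move=> Jc.
have Jprod (t : 'S_D) (l : seq 'I_D) : exists F, J 0 (size l * (M * d0)) F /\
    forall g, \prod_(i <- l) (sg g ^+ M *+ (i == t i) - c i (t i) g) =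
      (\prod_(i <- l) (i == t i)%:R) * sg g ^+ (M * size l) + F g.
  elim: l => [|i l [F [JF FE]]].
    exists 0; split=> [|g]; first exact: addcl0.
    by rewrite !big_nil muln0 expr0 mulr1 addr0.
  exists ((fun=> (i == t i)%:R) * (F * sg ^+ M) -
     ((fun=> \prod_(i <- l) (i == t i)%:R) * (c i (t i) * sg ^+ (M * size l)) +
         c i (t i) * F)).
  split=> [|g].
    apply: addclD; last apply: J_opp; last apply: addclD.
    - apply: (J_scale px); rewrite /= mulSn addnC; apply: (J_mulR px) => //.
      exact: R_exp.
    - apply: (J_scale px); rewrite /= mulSn; apply: (J_mulR px) => //.
      rewrite mulnA [(_ * M)%N]mulnC; exact: R_exp.
    - by rewrite /= mulSn; apply: (J_mul px).
  rewrite !big_cons FE !(addrfctE, mulrfctE, opprfctE, exprfctE) mulnS exprD -mulr_natl.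
  ring.
have /choice[P HP] := fun t => Jprod t (index_enum 'I_D).
exists (\sum_(t : 'S_D) (fun=> (-1) ^+ t) * P t); split=> [|g].
  elim/big_ind: _ => [|F F'|t _]; first exact: addcl0; first exact: addclD.
  apply: (J_scale px); have [JP _] := HP t; move: JP.
  by rewrite /index_enum -enumT size_enum_ord.
rewrite /determinant fct_sumE.
transitivity (\sum_(t : 'S_D) ((-1) ^+ t * \prod_i (1%:M :
    'M[C]_D) i (t i) * sg g ^+ (M * D) + ((fun=> (-1) ^+ t) * P t) g)).
  apply: eq_bigr => t _; rewrite mulrfctE -mulrA -mulrDr; congr (_ * _).
  have := (HP t).2 g; rewrite {3}/index_enum -enumT size_enum_ord => E.
  transitivity (\prod_(i < D) (sg g ^+ M *+ (i == t i) - c i (t i) g)).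
    by apply: eq_bigr => i _; rewrite !mxE.
  rewrite E; congr (_ * _ + _); by apply: eq_bigr => i _; rewrite mxE.
by rewrite big_split /= -mulr_suml -/(determinant 1%:M) det1 mul1r.
Qed.

(* The determinant trick: [sg ^+ M] is an eigenvalue, at every [g], of the
   matrix expressing its multiples of the words of length [N] in these words. *)
Lemma no_point_absurd : False.
Proof.
have [M [N [M_gt0 HMN]]] := words_step.
pose T := (N.-tuple {ffun 'I_r -> 'I_n})%type.
have /choice[c Hc] := fun w : T => J_decomp (HMN w (size_tuple w)).
pose D := #|{: T}|; pose ev (i : 'I_D) : T := enum_val i.
have [F [JF FE]] := J_det (c := fun i j => c (ev i) (ev j)) (fun i j => (Hc
    (ev i)).1 (ev j)).
have sgF : sg ^+ (M * D) = - F.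
  apply/funext => g; rewrite exprfctE opprfctE; apply/eqP; rewrite -addr_eq0 -FE.
  rewrite -det_tr; apply/det0P; exists (\row_i mon (ev i) g).
    have [f f0] := exists_pl hr g.
    apply/rV0Pn; exists (enum_rank (nseq_tuple N f)).
    by rewrite mxE /ev enum_rankK mon_nseq expf_neq0.
  rewrite linearB /= tr_scalar_mx mulmxBr mul_mx_scalar.
  apply/rowP => i; rewrite !mxE mulrC.
  have /(congr1 (fun G : fn => G g)) := (Hc (ev i)).2.
  rewrite mulrfctE exprfctE fct_sumE => ->.
  rewrite (reindex ev) /=; last by apply: onW_bij; exact: enum_val_bij.
  apply/eqP; rewrite subr_eq0; apply/eqP; apply: eq_bigr => j _.
  by rewrite !mxE mulrfctE mulrC.
apply: nxsg; apply: (prime_exp px (M := M * D)) => //.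
apply: (J_invariant hs px); last exact: R_exp.
by rewrite sgF [(M * D)%N]mulnC -mulnA; apply: J_opp.
Qed.

End Existence3.

Theorem exists_point (C : numClosedFieldType) (n r s : nat)
  (uC : ~ countable [set: C]) (hr : (r < n)%N) (hs : (s < n)%N) x d sg :
  homog_prime (@inv_sections C n r s) x -> (0 < d)%N ->
  inv_sections r s d sg -> ~ x d sg ->
  exists g, (forall d F, x d F -> F g = 0) /\ sg g <> 0.
Proof.
move=> px d0 Rsg nx; apply: contrapT => /forallNP H.
apply: (no_point_absurd uC hr hs px d0 Rsg nx) => g xg.
by apply: contrapT => sg0; apply: (H g).
Qed.

(** * Points of the quotient *)

Section Geometry.
Variables (C : numClosedFieldType) (n r s : nat).
Hypotheses (hr : (r < n)%N) (hs : (s < n)%N).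
Notation fn := (SL C n -> C).
Notation R := (@inv_sections C n r s).
Notation loR := (lo (ltnW hr)).
Notation hiR := (hi (ltnW hr)).
Implicit Types (g h u : SL C n) (F : fn).

Lemma mulmx_evec m (A : 'M[C]_(m, n)) (i : 'I_n) : A *m evec C n i.+1 = col i A.
Proof.
apply/matrixP => a b; rewrite !mxE (bigD1 i) //= big1 => [|j /negbTE ji].
  by rewrite mxE eqxx mulr1 addr0.
by rewrite mxE eqSS val_eqE ji mulr0.
Qed.

Lemma SLact_mul g h W : SLact (g * h)%g W = SLact g (SLact h W).
Proof.
rewrite /SLact -limg_comp; congr (_ @: _)%VS; apply/lfunP => v.
by rewrite comp_lfunE !lfunE /= mulmxA.
Qed.

Lemma base_pt_hi v j : v \in base_pt C n r -> v (hiR j) 0 = 0.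
Proof.
move=> /coord_span ->; rewrite summxE big1 // => i _.
have lti : (i < r)%N by have := ltn_ord i; rewrite /= ?size_map ?size_iota.
rewrite mxE (nth_map 0%N) ?size_iota //.
rewrite nth_iota // mxE /= add1n eqSS (_ : (_ == _) = false) ?mulr0 //.
by apply/negbTE; lia.
Qed.

Lemma SLact_eqP g g' : SLact g (base_pt C n r) = SLact g' (base_pt C n r) ->
  exists u c, parabolic r u c /\ g' = (g * u)%g.
Proof.
move=> E; pose u := (g^-1 * g')%g; exists u; rewrite /u mulVKg -/u.
have uE : SLact u (base_pt C n r) = base_pt C n r.
  rewrite SLact_mul -E -SLact_mul mulVg /SLact -[RHS]lim1g.
  by congr (_ @: _)%VS; apply/lfunP => v; rewrite !lfunE /= mul1mx.
exists (\det (mxsub loR loR u)); split=> //.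
exists (mxsub loR loR u), (mxsub loR hiR u), (mxsub hiR hiR u); split=> //.
rewrite -[LHS](blocknK (ltnW hr)); congr blockn; apply/matrixP => i j.
have: col (loR j) (u : 'M_n) \in base_pt C n r.
  rewrite -mulmx_evec -uE /SLact.
  have -> : u *m evec C n (loR j).+1 = linfun (mulmx (u : 'M_n)) (evec C n (loR j).+1).
    by rewrite lfunE.
  by apply/memv_img/memv_span/map_f; rewrite mem_iota /= ltnS ltn_ord.
by move=> /(base_pt_hi i); rewrite !mxE.
Qed.

Definition Q g := quot_pt r s (SLact g (base_pt C n r)).

Lemma QE g d F : Q g d F <-> R d F /\ F g = 0.
Proof.
split=> -[RF Fg]; split=> //; first exact: (Fg g erefl).
move=> g' /esym/SLact_eqP[u [c [pu ->]]].
by rewrite (section_parabolic _ RF.1 pu) Fg mulr0.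
Qed.

Lemma Q_eq g g' : (forall d F, R d F -> F g = 0 <-> F g' = 0) -> Q g = Q g'.
Proof.
move=> E; apply/funext => d; apply/seteqP; split=> F /QE[RF Fg]; apply/QE.
  by split=> //; apply/(E d F RF).
by split=> //; apply/(E d F RF).
Qed.

Lemma Q_parabolic g u c : parabolic r u c -> Q (g * u)%g = Q g.
Proof.
move=> pu; apply: Q_eq => d F [Fs _]; rewrite (section_parabolic _ Fs pu).
split=> [/eqP|->]; last by rewrite mulr0.
by rewrite mulf_eq0 expf_eq0 (negbTE (parabolic_neq0 hr pu)) andbF => /eqP.
Qed.

Lemma pt_act_Q h g : Hgrp s h -> pt_act r s h (Q g) = Q (h * g)%g.
Proof.
move=> hH; apply/funext => d; apply/seteqP; split=> F.
  by move=> [RF /QE[_ Fh]]; apply/QE.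
move=> /QE[RF Fh]; split=> //; apply/QE; split=> //.
exact: inv_sections_translate.
Qed.

Definition semistable g := exists d F, [/\ (0 < d)%N, R d F & F g != 0].

Lemma Q_homog_ideal g : homog_ideal R (Q g).
Proof.
split=> [d F /QE[]//|d|d F G|d e F G RF].
- by apply/QE; split=> //; apply: inv_sections0.
- move=> /QE[RF Fg] /QE[RG Gg]; apply/QE; split; first exact: inv_sectionsB.
  by rewrite addrfctE opprfctE Fg Gg subrr.
- move=> /QE[RG Gg]; apply/QE; split; first exact: inv_sectionsM.
  by rewrite mulrfctE Gg mulr0.
Qed.

Lemma Q_Proj g : semistable g -> Proj R (Q g).
Proof.
move=> [d [F [d0 RF Fg]]]; split; last first.
  by exists d; split=> // sub; case/QE: (sub F RF) => _ /eqP; apply/negP.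
split; first exact: Q_homog_ideal.
  by move=> /QE[_ /eqP]; rewrite oner_eq0.
move=> e e' F1 F2 R1 R2 /QE[_ /eqP]; rewrite mulrfctE mulf_eq0.
by case/orP => /eqP E; [left|right]; apply/QE.
Qed.

(* If a homogeneous prime [y] contains the ideal of [g] and a section [F] of
   degree [d] with [F g != 0], then it contains [G ^+ d] for all [G] in degree
   [e], since [F g ^+ e * G ^+ d - G g ^+ d * F ^+ e] vanishes at [g]. *)
Lemma Q_maximal g y : Proj R y -> (forall d, Q g d `<=` y d) -> y = Q g.
Proof.
move=> [py [e [e0 nsub]]] Qy; apply/funext => d; apply/seteqP; split=> [F yF|];
    last exact: Qy.
have RF := prime_sub py yF; apply/QE; split=> //; apply: contrapT => /eqP Fg.
case: nsub => G RG.
have inR : R (e * d)%N ((fun=> F g ^+ e) * G ^+ d - (fun=> G g ^+ d) * F ^+ e).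
  apply: inv_sectionsB; rewrite -[(e * d)%N]add0n; apply: inv_sectionsM.
  - exact: inv_sectionsC.
  - by rewrite mulnC; apply: R_exp.
  - exact: inv_sectionsC.
  - exact: R_exp.
have yD : y (e * d)%N ((fun=> F g ^+ e) * G ^+ d - (fun=> G g ^+ d) * F ^+ e).
  apply: Qy; apply/QE; split=> //.
  by rewrite addrfctE opprfctE !mulrfctE !exprfctE mulrC subrr.
have yFe : y (e * d)%N (F ^+ e).
  case: (e) e0 => // e1 _; rewrite exprSr mulSnr.
  by apply: (prime_mull py) => //; apply: R_exp.
have yG : y (e * d)%N (G ^+ d).
  have -> : G ^+ d = (fun=> (F g ^+ e)^-1) *
      (((fun=> F g ^+ e) * G ^+ d - (fun=> G g ^+ d) * F ^+ e) +
       (fun=> G g ^+ d) * F ^+ e).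
    rewrite subrK; apply/funext => z; rewrite !mulrfctE mulrA mulVf ?mul1r //.
    by rewrite expf_neq0.
  apply: (prime_scale py); apply: (primeD py) => //; exact: (prime_scale py).
by apply: (prime_exp py (M := d)) => //; rewrite mulnC.
Qed.

Lemma Q_closed g : semistable g -> closed_points R (Q g).
Proof.
move=> ss; split; first exact: Q_Proj.
exists (Q g); first exact: Q_homog_ideal.
apply/seteqP; split=> [_ ->|y [Py Qy]]; first by split; [exact: Q_Proj|move=> d F].
exact: Q_maximal.
Qed.

(** A common zero [g] of [y] outside the zeros of some section gives a point [Q g] of Proj
    containing [y]. It lies in every closed set through [y], in particular in the singleton of
    [y]. *)
Lemma closed_point_Q (uC : ~ countable [set: C]) y : closed_points R y ->
  exists2 g, semistable g & y = Q g.
Proof.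
move=> [Py [J idJ yJ]]; have [py [d [d0 /existsNP[F /not_implyP[RF nF]]]]] := Py.
have [g [gy Fg]] := exists_point uC hr hs py d0 RF nF.
have ss : semistable g by exists d, F; split=> //; apply/eqP.
exists g => //; have [_ Jy] : [set z | Proj R z /\ forall d, J d `<=` z d] y.
  by rewrite -yJ.
have : [set y] (Q g).
  rewrite yJ; split; first exact: Q_Proj.
  move=> e G /Jy yG; apply/QE; split; first by apply: (prime_sub py); exact: yG.
  exact: gy yG.
by move=> /= ->.
Qed.

End Geometry.

(** * Normal form under H and the parabolic *)

Section LinearAlgebra.
Variable C : fieldType.

(** In the applications [U] has entries 0 and 1, with at most one 1 in each row and column. The
    first hypothesis says that [M] vanishes outside the rows that [U] selects, and the second that
    the selected rows are independent, so that they extend to an invertible matrix. *)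
Lemma complete_rows m q (U M : 'M[C]_(m, q)) : U *m U^T *m M = M ->
  (\rank U <= \rank M)%N -> exists2 L, L \in unitmx & M = U *m L.
Proof.
move=> UM rk; have rkU : \rank (U *m (U^T *m M)) = \rank U.
  by apply/eqP; rewrite eqn_leq mxrankM_maxl /= mulmxA UM.
have [L uL LE] := complete_unitmx rkU.
by exists L => //; rewrite -LE mulmxA.
Qed.

Lemma mxrank_rowsub_le m m' q (f : 'I_m' -> 'I_m) (A : 'M[C]_(m, q)) :
  (\rank (rowsub f A) <= \rank A)%N.
Proof. by rewrite -[A in rowsub f A]mul1mx -mul_rowsub_mx mxrankM_maxr. Qed.

Definition shift_mx k m q : 'M[C]_(m, q) := \matrix_(i, b) (i == (k + b)%N :> nat)%:R.

Lemma shift_mx_mul k m q m' (M : 'M[C]_(q, m')) (i : 'I_m) (b : 'I_q) j :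
  i = (k + b)%N :> nat -> (shift_mx k m q *m M) i j = M b j.
Proof.
move=> iE; rewrite mxE (bigD1 b) //= mxE iE eqxx mul1r big1 ?addr0 // => b' bb'.
by rewrite mxE iE eqn_add2l eq_sym val_eqE (negbTE bb') mul0r.
Qed.

Lemma shift_mx_mul0 k m q m' (M : 'M[C]_(q, m')) (i : 'I_m) j :
  (forall b : 'I_q, i <> (k + b)%N :> nat) -> (shift_mx k m q *m M) i j = 0.
Proof.
by move=> H; rewrite mxE big1 // => b _; rewrite mxE; case: eqP => [/H|];
    rewrite ?mul0r.
Qed.

Lemma shift_mx_proj k m q m' (M : 'M[C]_(m, m')) :
  (forall (i : 'I_m) j, ~ (k <= i < k + q)%N -> M i j = 0) ->
  shift_mx k m q *m (shift_mx k m q)^T *m M = M.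
Proof.
move=> M0; apply/matrixP => i j; rewrite -mulmxA.
have [/andP[l1 l2]|nin] := boolP (k <= i < k + q)%N; last first.
  rewrite M0; last exact/negP.
  by apply: shift_mx_mul0 => b E; case/negP: nin; have := ltn_ord b; lia.
have lt : (i - k < q)%N by lia.
rewrite (@shift_mx_mul _ _ _ _ _ _ (Ordinal lt)) /=; last lia.
rewrite mxE (bigD1 i) //= !mxE /= subnKC // eqxx mul1r big1 ?addr0 // => i' ii'.
by rewrite !mxE /= subnKC // val_eqE (negbTE ii') mul0r.
Qed.

Lemma rank_shift_mx_le k m q : (\rank (shift_mx k m q) <= minn (m - k) q)%N.
Proof.
rewrite leq_min rank_leq_col andbT.
have -> : shift_mx k m q = shift_mx k m (m - k) *m pid_mx (m - k).
  apply/matrixP => i b; have [/subnKC E|lt] := leqP k i; last first.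
    rewrite shift_mx_mul0 ?mxE => [|b']; last lia.
    by rewrite (_ : _ == _ = false) //; apply/negbTE; lia.
  have lt : (i - k < m - k)%N by have := ltn_ord i; lia.
  rewrite (@shift_mx_mul _ _ _ _ _ _ (Ordinal lt)) //= !mxE /= lt andbT.
  by rewrite -{1}E eqn_add2l.
exact: leq_trans (mxrankM_maxl _ _) (rank_leq_col _).
Qed.

Lemma shift_mx_trmul k m q m' (M : 'M[C]_(m, m')) (i : 'I_m) (b : 'I_q) j :
  i = (k + b)%N :> nat -> ((shift_mx k m q)^T *m M) b j = M i j.
Proof.
move=> iE; rewrite mxE (bigD1 i) //= !mxE iE eqxx mul1r big1 ?addr0 // => i' ii'.
by rewrite !mxE -iE val_eqE (negbTE ii') mul0r.
Qed.

Lemma shift_mx_trK k m q : (k + q <= m)%N ->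
  (shift_mx k m q)^T *m shift_mx k m q = 1%:M.
Proof.
move=> le; apply/matrixP => b b'; have lt : (k + b < m)%N by have := ltn_ord b; lia.
by rewrite (@shift_mx_trmul _ _ _ _ _ (Ordinal lt)) // !mxE /= eqn_add2l.
Qed.

Lemma shift_mx_tr0 k m q k' q' : (k' + q' <= k)%N ->
  (shift_mx k m q)^T *m shift_mx k' m q' = 0.
Proof.
move=> le; apply/matrixP => b b'; rewrite !mxE big1 // => i _; rewrite !mxE.
case: eqP => [->|]; rewrite ?mul0r // (_ : (_ == _) = false) ?mulr0 //.
by apply/negbTE; have := ltn_ord b'; lia.
Qed.

(** As the two kernels are independent, a basis can be chosen with its first vectors in the kernel
    of [A2] and its last vectors in the kernel of [A1]. The rows of [P] are this basis. *)
Lemma adapted_basis r m1 m2 (A1 : 'M[C]_(r, m1)) (A2 : 'M[C]_(r, m2)) :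
  (kermx A1 :&: kermx A2 = 0)%MS -> exists2 P : 'M_r, P \in unitmx &
  (forall (i : 'I_r) j, (\rank A1 <= i)%N -> (P *m A1) i j = 0) /\
  (forall (i : 'I_r) j, (i < r - \rank A2)%N -> (P *m A2) i j = 0).
Proof.
move=> cap0; set K1 := kermx A1; set K2 := kermx A2.
set d1 := \rank A1; set k := (r - \rank A2)%N.
have rK1 : \rank K1 = (r - d1)%N by rewrite mxrank_ker.
have rK2 : \rank K2 = k by rewrite mxrank_ker.
have rK := mxrank_disjoint_sum cap0; rewrite -/K1 -/K2 rK1 rK2 in rK.
have ler : (r - d1 + k <= r)%N by rewrite -rK rank_leq_col.
have led1 : (d1 <= r)%N by rewrite rank_leq_row.
have [B1 B1E] : exists B1 : 'M_(r - d1, r), (B1 :=: K1)%MS.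
  by rewrite -rK1; exists (row_base K1); apply: eq_row_base.
have [B2 B2E] : exists B2 : 'M_(k, r), (B2 :=: K2)%MS.
  by rewrite -rK2; exists (row_base K2); apply: eq_row_base.
pose S1 : 'M[C]_(r, r - d1) := shift_mx d1 _ _.
pose S2 : 'M[C]_(r, k) := shift_mx 0 _ _.
(* Both kernel bases are written into their final rows, with zeros between; completing [V] to an
   invertible matrix gives [P]. *)
pose V := S1 *m B1 + S2 *m B2; pose U : 'M[C]_r := S1 *m S1^T + S2 *m S2^T.
have S11 : S1^T *m S1 = 1%:M by apply: shift_mx_trK; lia.
have S22 : S2^T *m S2 = 1%:M by apply: shift_mx_trK; rewrite /k; lia.
have S12 : S1^T *m S2 = 0 by apply: shift_mx_tr0; lia.
have S21 : S2^T *m S1 = 0 by rewrite -[LHS]trmxK trmx_mul trmxK S12 trmx0.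
have UT : U^T = U by rewrite /U linearD /= !trmx_mul !trmxK.
have S1U : S1^T *m U = S1^T by rewrite /U mulmxDr !mulmxA S11 S12 mul1mx mul0mx addr0.
have S2U : S2^T *m U = S2^T by rewrite /U mulmxDr !mulmxA S21 S22 mul1mx mul0mx add0r.
have US1 : U *m S1 = S1 by rewrite -[LHS]trmxK trmx_mul UT S1U trmxK.
have US2 : U *m S2 = S2 by rewrite -[LHS]trmxK trmx_mul UT S2U trmxK.
have S1V : S1^T *m V = B1 by rewrite /V mulmxDr !mulmxA S11 S12 mul1mx mul0mx addr0.
have S2V : S2^T *m V = B2 by rewrite /V mulmxDr !mulmxA S21 S22 mul1mx mul0mx add0r.
have rkU : (\rank U <= r - d1 + k)%N.
  apply: leq_trans (mxrank_add _ _) _; apply: leq_add.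
    exact: leq_trans (mxrankM_maxl _ _) (rank_leq_col _).
  exact: leq_trans (mxrankM_maxl _ _) (rank_leq_col _).
have [P uP VE] : exists2 P, P \in unitmx & V = U *m P.
  apply: complete_rows.
    have UV : U *m V = V by rewrite /V mulmxDr !mulmxA US1 US2.
    by rewrite UT -mulmxA !UV.
  apply: leq_trans rkU _; rewrite -rK; apply: mxrankS; rewrite addsmx_sub.
  by rewrite -B1E -B2E -S1V -S2V !submxMl.
have S1P : S1^T *m P = B1 by rewrite -S1U -mulmxA -VE S1V.
have S2P : S2^T *m P = B2 by rewrite -S2U -mulmxA -VE S2V.
exists P => //; split=> i j lei.
  have lt : (i - d1 < r - d1)%N by have := ltn_ord i; lia.
  have := @shift_mx_trmul d1 _ _ _ (P *m A1) i (Ordinal lt) j.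
  rewrite /= subnKC // => /(_ erefl) <-; rewrite mulmxA S1P.
  have /sub_kermxP -> : (B1 <= kermx A1)%MS by rewrite B1E.
  by rewrite mxE.
have := @shift_mx_trmul 0 _ _ _ (P *m A2) i (Ordinal lei) j.
move=> /(_ erefl) <-; rewrite mulmxA S2P.
have /sub_kermxP -> : (B2 <= kermx A2)%MS by rewrite B2E.
  by rewrite mxE.
Qed.

(** The hypothesis says that the two blocks, stacked, have independent columns. Row operations act
    on each block separately but column operations act on both, so the common [P] has to be adapted
    to both kernels. *)
Lemma pair_normal_form r m1 m2 (N1 : 'M[C]_(m1, r)) (N2 : 'M[C]_(m2, r)) :
  (kermx N1^T :&: kermx N2^T = 0)%MS ->
  exists (L1 : 'M_m1) (L2 : 'M_m2) (P : 'M_r),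
  [/\ L1 \in unitmx, L2 \in unitmx, N1 = L1 *m pid_mx (\rank N1) *m P
    & N2 = L2 *m (shift_mx (r - \rank N2) r m2)^T *m P].
Proof.
move=> /adapted_basis[P uP []]; rewrite !mxrank_tr => P1 P2.
have rkP m (A : 'M_(r, m)) : \rank (P *m A) = \rank A.
  by rewrite (eqmxMfull A) ?row_full_unit.
have [L1 uL1 E1] : exists2 L, L \in unitmx & P *m N1^T = pid_mx (\rank N1) *m L.
  apply: complete_rows; last by rewrite rkP mxrank_tr rank_pid_mx ?rank_leq_row
      ?rank_leq_col.
  rewrite tr_pid_mx mul_pid_mx minnn (minn_idPr (rank_leq_row _)).
  apply/matrixP => i j; rewrite mxE (bigD1 i) //= big1 => [|i' ii']; last first.
    by rewrite mxE eq_sym val_eqE (negbTE ii') mul0r.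
  rewrite mxE eqxx /= addr0; case: ltnP => [|/P1 ->]; rewrite ?mul1r ?mulr0 //.
have [L2 uL2 E2] : exists2 L, L \in unitmx &
    P *m N2^T = shift_mx (r - \rank N2) r m2 *m L.
  have le1 := rank_leq_row N2; have le2 := rank_leq_col N2.
  apply: complete_rows; last first.
    rewrite rkP mxrank_tr; apply: leq_trans (rank_shift_mx_le _ _ _) _.
    by rewrite geq_min subKn ?leqnn.
  apply: shift_mx_proj => i j H; apply: P2; have := ltn_ord i; lia.
exists L1^T, L2^T, (invmx P)^T; rewrite !unitmx_tr; split=> //.
  by rewrite -[LHS]trmxK -{1}(mulKmx uP N1^T) E1 !trmx_mul tr_pid_mx.
by rewrite -[LHS]trmxK -{1}(mulKmx uP N2^T) E2 !trmx_mul.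
Qed.

End LinearAlgebra.

Section NormalForm.
Variables (C : numClosedFieldType) (n r s : nat).
Hypotheses (hr : (r < n)%N) (hs : (s < n)%N).
Notation fn := (SL C n -> C).
Notation R := (@inv_sections C n r s).
Notation loR := (lo (ltnW hr)).
Notation hiR := (hi (ltnW hr)).
Notation loS := (lo (ltnW hs)).
Notation hiS := (hi (ltnW hs)).
Implicit Types (g h u : SL C n) (F : fn).

Definition rk_up g := \rank (mxsub loS loR (g : 'M_n)).
Definition rk_down g := \rank (mxsub hiS loR (g : 'M_n)).

(* The columns are e_1, ..., e_k, then e_{s+j} + e_{k+j} for 1 <= j <= m - k,
   then e_{s+j} for m - k < j <= r - k. *)
Definition nf k m : 'M[C]_(n, r) := \matrix_(a, i)
  (if (a < s)%N then (a == i :> nat) && (i < m)%N else (i == (k +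
      (a - s))%N :> nat))%:R.

Lemma nf_up k m : rowsub loS (nf k m) = pid_mx m.
Proof.
apply/matrixP => a i; rewrite !mxE /= ltn_ord.
by case: eqP => [->|].
Qed.

Lemma nf_down k m : rowsub hiS (nf k m) = (shift_mx C k r (n - s))^T.
Proof. by apply/matrixP => a i; rewrite !mxE /= ltnNge leq_addr /= addKn. Qed.

(** A coset of P is determined by the span of the first [r] columns; this reduces equalities in G/P
    to equalities between [n] by [r] matrices. *)
Lemma colsub_parabolic g g' (a : 'M_r) :
  colsub loR (g' : 'M_n) = colsub loR (g : 'M_n) *m a ->
  exists2 u, parabolic r u (\det a) & g' = (g * u)%g.
Proof.
move=> E; pose u := (g^-1 * g')%g; exists u; last by rewrite /u mulVKg.
have uE q (f : 'I_q -> 'I_n) : mxsub f loR u = mxsub f loR (1%:M : 'M_n) *m a.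
  rewrite -(mulVmx (SL_unitmx g)) /= !mxsub_mul -mulmxA -E.
  by congr (_ *m _); apply/matrixP => i j; rewrite !mxE.
exists a, (mxsub loR hiR u), (mxsub hiR hiR u); split=> //.
rewrite -[LHS](blocknK (ltnW hr)) !uE; congr blockn.
  have -> : mxsub loR loR (1%:M : 'M[C]_n) = 1%:M.
    by apply/matrixP => i j; rewrite !mxE -val_eqE.
  by rewrite mul1mx.
have -> : mxsub hiR loR (1%:M : 'M[C]_n) = 0.
  apply/matrixP => i j; rewrite !mxE (_ : _ == _ = false) //.
  by apply/negbTE; rewrite -val_eqE /=; have := ltn_ord j; lia.
by rewrite mul0mx.
Qed.

Lemma colsub_row_full g : row_full (colsub loR (g : 'M_n)).
Proof.
apply/row_fullP; exists (rowsub loR (invmx g)).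
rewrite -mxsub_mul mulVmx ?SL_unitmx //.
by apply/matrixP => i j; rewrite !mxE -val_eqE.
Qed.

Lemma jointly_injective g :
  (kermx (mxsub loS loR (g : 'M_n))^T :&: kermx (mxsub hiS loR (g : 'M_n))^T = 0)%MS.
Proof.
apply/eqP/rowV0P => v; rewrite sub_capmx => /andP[/sub_kermxP v1 /sub_kermxP v2].
have [B BE] := row_fullP (colsub_row_full g).
have : v *m (colsub loR (g : 'M_n))^T = 0.
  apply: trmx_inj; rewrite trmx_mul trmxK trmx0.
  apply: (matrix_lo_hiP (hk := ltnW hs)); rewrite -mul_rowsub_mx.
    have <- : mxsub loS loR (g : 'M_n) = rowsub loS (colsub loR (g : 'M_n)).
      by apply/matrixP => i j; rewrite !mxE.
    rewrite -[mxsub _ _ _]trmxK -trmx_mul v1; by apply/matrixP => i j; rewrite !mxE.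
  have <- : mxsub hiS loR (g : 'M_n) = rowsub hiS (colsub loR (g : 'M_n)).
    by apply/matrixP => i j; rewrite !mxE.
  rewrite -[mxsub _ _ _]trmxK -trmx_mul v2; by apply/matrixP => i j; rewrite !mxE.
move=> /(congr1 (mulmx^~ B^T)); rewrite mul0mx -mulmxA -trmx_mul BE trmx1.
by rewrite mulmx1.
Qed.

Lemma unit_SL m (L : 'M[C]_m) : (0 < m)%N -> L \in unitmx ->
  exists c L', [/\ c != 0, \det L' = 1 & L = c *: L'].
Proof.
move=> m0; rewrite unitmxE unitfE => L0; pose c := m.-root (\det L).
have cm : c ^+ m = \det L by rewrite rootCK.
have c0 : c != 0 by apply: contraNneq L0 => c0; rewrite -cm c0 expr0n gtn_eqF.
exists c, (c^-1 *: L); split=> //.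
  by rewrite detZ exprVn cm mulVf.
by rewrite scalerA mulfV // scale1r.
Qed.

Lemma normal_form g : (0 < s)%N -> exists h t (a : 'M_r),
  [/\ Hgrp s h, t != 0 & colsub loR (g : 'M_n) =
    h *m (lambda n s t *m nf (r - rk_down g) (rk_up g)) *m a].
Proof.
move=> s_gt0; have [L1 [L2 [P [u1 u2 E1 E2]]]] :=
    pair_normal_form (jointly_injective g).
have [c1 [L1' [c10 d1 L1E]]] := unit_SL s_gt0 u1.
have ns_gt0 : (0 < n - s)%N by rewrite subn_gt0.
have [c2 [L2' [c20 d2 L2E]]] := unit_SL ns_gt0 u2.
have n_gt0 : (0 < n)%N by apply: leq_ltn_trans hs.
(* Passing from GL to SL leaves the scalars [c1] and [c2] on the two blocks. The action of lambda
   changes their ratio by [t ^+ n], and the remaining common factor [c2 * t ^+ s] goes into P. *)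
pose t := n.-root (c1 / c2); have tn : t ^+ n = c1 / c2 by rewrite rootCK.
have t0 : t != 0.
  have : c1 / c2 != 0 by rewrite mulf_neq0 // invr_neq0.
  by apply: contraNneq => t0; rewrite -tn t0 expr0n gtn_eqF.
have dh : \det (@blockn C n s L1' 0 0 L2') == 1.
  by rewrite (det_blockn (ltnW hs)) d1 d2 mulr1.
exists (MkSL dh), t, (c2 * t ^+ s *: P); split=> //; first by exists L1', L2'.
have ts : t ^+ s != 0 by rewrite expf_neq0.
rewrite /= (lambda_blockn hs) mulmxA (blockn_mul (ltnW hs)).
rewrite !(mulmx0, mul0mx, addr0, add0r) !mul_mx_scalar.
have up m (M : 'M[C]_(n, m)) a d :
    rowsub loS (@blockn C n s a 0 0 d *m M) = a *m rowsub loS M.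
  by rewrite (mxsub_mul_lo_hi (ltnW hs)) blockn_ul blockn_ur mul0mx addr0.
have down m (M : 'M[C]_(n, m)) a d :
    rowsub hiS (@blockn C n s a 0 0 d *m M) = d *m rowsub hiS M.
  by rewrite (mxsub_mul_lo_hi (ltnW hs)) blockn_dl blockn_dr mul0mx add0r.
apply: (matrix_lo_hiP (hk := ltnW hs)).
  have -> : rowsub loS (colsub loR (g : 'M_n)) = mxsub loS loR (g : 'M_n).
    by apply/matrixP => i j; rewrite !mxE.
  rewrite -mul_rowsub_mx up nf_up E1 -/(rk_up g) L1E.
  rewrite -!scalemxAl -!scalemxAr scalerA; congr (_ *: _).
  by rewrite mulrCA -exprD subnK ?(ltnW hs) // tn mulrC divfK.
have -> : rowsub hiS (colsub loR (g : 'M_n)) = mxsub hiS loR (g : 'M_n).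
  by apply/matrixP => i j; rewrite !mxE.
rewrite -mul_rowsub_mx down nf_down E2 -/(rk_down g) L2E.
rewrite -!scalemxAl -!scalemxAr scalerA; congr (_ *: _).
by rewrite mulrCA mulVf // mulr1.
Qed.

Lemma rk_up_le g : (rk_up g <= minn r s)%N.
Proof. by rewrite leq_min rank_leq_col rank_leq_row. Qed.

Lemma rk_down_le g : (rk_down g <= minn r (n - s))%N.
Proof. by rewrite leq_min rank_leq_col rank_leq_row. Qed.

Lemma rk_sum g : (r <= rk_up g + rk_down g)%N.
Proof.
have := mxrank_disjoint_sum (jointly_injective g).
rewrite !mxrank_ker !mxrank_tr -/(rk_up g) -/(rk_down g) => E.
have := rank_leq_col (kermx (mxsub loS loR (g :
    'M_n))^T + kermx (mxsub hiS loR (g : 'M_n))^T)%MS.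
rewrite E; have := rk_up_le g; have := rk_down_le g. lia.
Qed.

(** ** Representatives of the normal forms *)

Definition uniS (X : 'M[C]_(s, n - s)) : 'M[C]_n := blockn 1%:M X 0 1%:M.

Fact uniS_det X : \det (uniS X) == 1.
Proof. by rewrite /uniS (det_blockn (ltnW hs)) !det1 mulr1. Qed.

Definition uniSL X : SL C n := MkSL (uniS_det X).

(** Rows on which [nf k l] restricts to the identity whenever [m <= l]: an upper one for each of the
    first [m] columns, a lower one for the others. Under the bounds of [Frame] the default value of
    [insubd] is never taken. *)
Definition idx k m : {ffun 'I_r -> 'I_n} :=
  [ffun i => insubd (loR i) (if (i < m)%N then i : nat else (s + (i - k))%N)].

Section Frame.
Variables k m : nat.
Hypotheses (km : (k <= m)%N) (ms : (m <= s)%N) (mr : (m <= r)%N) (rk :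
    (r - k <= n - s)%N).

Lemma val_idx i : idx k m i = (if (i < m)%N then i : nat else (s + (i - k))%N) :> nat.
Proof.
rewrite ffunE val_insubd; case: ifP => // /negP[].
by have := ltn_ord i; have [] := ltnP i m; lia.
Qed.

Lemma idx_inj : injective (idx k m).
Proof.
move=> i j /(congr1 val); rewrite /= !val_idx => E; apply: val_inj => /=.
by move: E; have [] := ltnP i m; have [] := ltnP j m; lia.
Qed.

Lemma wt_idx : wt s (idx k m) = (n * m)%N%:Z - (r * s)%N%:Z.
Proof.
rewrite /wt big_split /= sumr_const card_ord mulNrn; congr (_ - _); last first.
  by rewrite -mulr_natr natz -PoszM mulnC.
have lt_s i : (idx k m i < s)%N = (i < m)%N.
  by rewrite val_idx; case: ifP => // lt; apply/idP/idP; lia.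
under eq_bigr do rewrite lt_s.
rewrite -(big_mkord xpredT (fun i => (n * (i < m))%N%:Z)) (big_cat_nat _ (n := m)) //=.
rewrite [X in X + _]big_nat [X in X + _](eq_bigr (fun=> n%:Z)); last first.
  by move=> i /andP[_ ->]; rewrite muln1.
rewrite -[X in X + _]big_nat.
rewrite [X in _ + X]big_nat_cond [X in _ + X]big1 ?addr0; last first.
  by move=> i /andP[/andP[le _] _]; rewrite ltnNge le muln0.
by rewrite sumr_const_nat subn0 -mulr_natr natz -PoszM.
Qed.

Lemma idx_nf l : (m <= l)%N -> rowsub (idx k m) (nf k l) = 1%:M.
Proof.
move=> ml; apply/matrixP => i j; rewrite !mxE val_idx -val_eqE /=.
have [im|im] := ltnP i m.
  have -> : (i < s)%N by lia.
  by case: eqP => // <-; rewrite (leq_trans im ml).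
rewrite ltnNge leq_addr /= addKn eq_sym; congr ((_ == _)%:R); lia.
Qed.

Lemma rk_up_pl g : pl hr (idx k m) g != 0 -> (m <= rk_up g)%N.
Proof.
rewrite plE => det0; set W := mxsub _ _ _ in det0.
have uW : W \in unitmx by rewrite unitmxE unitfE.
have <- : \rank (rowsub (widen_ord mr) W) = m.
  rewrite -[W in rowsub _ W]mul1mx -mul_rowsub_mx mxrankMfree ?row_free_unit //.
  have -> : rowsub (widen_ord mr) (1%:M : 'M[C]_r) = pid_mx m.
    by apply/matrixP => i j; rewrite !mxE -val_eqE /= ltn_ord andbT.
  by rewrite rank_pid_mx.
have -> : rowsub (widen_ord mr) W = rowsub (widen_ord ms) (mxsub loS loR (g : 'M_n)).
  apply/matrixP => i j; rewrite !mxE; congr ((g : 'M_n) _ _); apply: val_inj.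
  by rewrite /= val_idx /= ltn_ord.
exact: mxrank_rowsub_le.
Qed.



End Frame.

Section Representatives.
Variable k : nat.
Hypotheses (ks : (k <= s)%N) (kr : (k <= r)%N) (rk : (r - k <= n - s)%N).

Lemma exists_frame : exists w : SL C n, colsub loR (w : 'M_n) = colsub (idx k k) 1%:M.
Proof.
have [w wE] := exists_SL_rows C hr (idx_inj (leqnn k) ks kr rk).
have dw : \det (w : 'M_n)^T == 1 by rewrite det_tr (eqP (SL_det w)).
exists (MkSL dw) => /=; apply: trmx_inj.
apply/matrixP => i j; have /matrixP/(_ i j) := wE; rewrite !mxE => ->.
by rewrite eq_sym.
Qed.

Definition frame : SL C n := projT1 (cid exists_frame).

Lemma frameE : colsub loR (frame : 'M_n) = colsub (idx k k) 1%:M.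
Proof. by rewrite /frame; case: (cid exists_frame). Qed.

(** Its first [r] columns are e_1, ..., e_k followed by the e_{s+j} plus the [j]-th column of [X].
    The normal forms of lower rank [r - k] occur here in a family polynomial in [X], as needed for
    degenerations. *)
Definition rep X : SL C n := (uniSL X * frame)%g.

Lemma rep_col X : colsub loR (rep X : 'M_n) = colsub (idx k k) (uniS X).
Proof.
have E (m : 'I_r -> 'I_n) (A B : 'M[C]_n) : colsub m (A *m B) = A *m colsub m B.
  by apply/matrixP => i j; rewrite !mxE; apply: eq_bigr => l _; rewrite !mxE.
by rewrite /rep /= E frameE -E mulmx1.
Qed.

Definition nfX m : 'M[C]_(s, n - s) :=
  \matrix_(a, b) ((a == (k + b)%N :> nat) && (a < m)%N)%:R.

Lemma idx_lo (i : 'I_r) (ik : (i < k)%N) : idx k k i = loS (Ordinal (leq_trans ik ks)).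
Proof. by apply: val_inj; rewrite /= val_idx // ik. Qed.

Fact idx_hi_lt (i : 'I_r) : (k <= i)%N -> (i - k < n - s)%N.
Proof. by have := ltn_ord i; lia. Qed.

Lemma idx_hi (i : 'I_r) (ki : (k <= i)%N) : idx k k i = hiS (Ordinal (idx_hi_lt ki)).
Proof. by apply: val_inj; rewrite /= val_idx // ltnNge ki. Qed.

Lemma uniS_ll X a b : uniS X (loS a) (loS b) = (a == b)%:R.
Proof. by have /matrixP/(_ a b) := blockn_ul (ltnW hs) 1%:M X 0 1%:M; rewrite !mxE. Qed.
Lemma uniS_lh X a b : uniS X (loS a) (hiS b) = X a b.
Proof. by have /matrixP/(_ a b) := blockn_ur (ltnW hs) 1%:M X 0 1%:M; rewrite !mxE. Qed.
Lemma uniS_hl X a b : uniS X (hiS a) (loS b) = 0.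
Proof. by have /matrixP/(_ a b) := blockn_dl (ltnW hs) 1%:M X 0 1%:M; rewrite !mxE. Qed.
Lemma uniS_hh X a b : uniS X (hiS a) (hiS b) = (a == b)%:R.
Proof. by have /matrixP/(_ a b) := blockn_dr (ltnW hs) 1%:M X 0 1%:M; rewrite !mxE. Qed.

Lemma rep_nf m : (k <= m)%N -> colsub loR (rep (nfX m) : 'M_n) = nf k m.
Proof.
move=> km; rewrite rep_col; apply/matrixP => a i; rewrite [LHS]mxE [RHS]mxE.
have [ik|ki] := ltnP i k; [rewrite (idx_lo ik)|rewrite (idx_hi ki)];
  case: (lo_hiP (ltnW hs) a) => [] [a' ->];
      rewrite /= ?ltn_ord ?[(s + _ < s)%N]ltnNge ?leq_addr /=.
- by rewrite uniS_ll -val_eqE /= (leq_trans ik km) andbT.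
- by rewrite uniS_hl addKn (_ : (_ == _) = false) //; apply/negbTE; lia.
- by rewrite uniS_lh mxE /= subnKC //; case: eqP => // ->.
- by rewrite uniS_hh -val_eqE /= addKn; congr (_%:R); apply/eqP/eqP; lia.
Qed.

Lemma rep_rk_down X : rk_down (rep X) = (r - k)%N.
Proof.
have -> : rk_down (rep X) = \rank (rowsub hiS (nf k k)).
  rewrite /rk_down; congr (\rank _).
  have -> : mxsub hiS loR (rep X : 'M_n) = rowsub hiS (colsub loR (rep X : 'M_n)).
    by apply/matrixP => i j; rewrite !mxE.
  rewrite rep_col; apply/matrixP => a i; rewrite [LHS]mxE [LHS]mxE [RHS]mxE [RHS]mxE.
  have [ik|ki] := ltnP i k; [rewrite (idx_lo ik)|rewrite (idx_hi ki)];
    rewrite /= ?[(s + _ < s)%N]ltnNge ?leq_addr /= addKn.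
  - by rewrite uniS_hl (_ : (_ == _) = false) //; apply/negbTE; lia.
  - by rewrite uniS_hh -val_eqE /=; congr (_%:R); apply/eqP/eqP; lia.
rewrite nf_down mxrank_tr; apply/eqP; rewrite eqn_leq.
rewrite (leq_trans (rank_shift_mx_le _ _ _ _)) ?geq_minl //=.
have -> : (r - k)%N = \rank (shift_mx C k r (r - k)).
  have le : (k + (r - k) <= r)%N by lia.
  have E := congr1 (fun M : 'M_(r - k) => \rank M) (shift_mx_trK C le).
  rewrite /= mxrank1 in E; apply/eqP; rewrite eqn_leq rank_leq_col andbT.
  by rewrite -{1}E mxrankM_maxr.
have -> : shift_mx C k r (r - k) = shift_mx C k r (n - s) *m pid_mx (r - k).
  apply/matrixP => i b; have [ki|ik] := leqP k i; last first.
    rewrite shift_mx_mul0 ?mxE => [|b']; last lia.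
    by rewrite (_ : _ == _ = false) //; apply/negbTE; lia.
  rewrite (@shift_mx_mul _ _ _ _ _ _ _ (Ordinal (idx_hi_lt ki))) /=;
      last by rewrite subnKC.
  rewrite !mxE /=; congr (_%:R); have := ltn_ord i; have := ltn_ord b.
  by case: eqP; case: eqP => //=; lia.
exact: mxrankM_maxl.
Qed.

Lemma rep_nf_rk_up m : (k <= m)%N -> (m <= minn r s)%N -> rk_up (rep (nfX m)) = m.
Proof.
move=> km; rewrite leq_min => /andP[mr ms].
rewrite /rk_up; have -> : mxsub loS loR (rep (nfX m) : 'M_n) =
    rowsub loS (colsub loR (rep (nfX m) : 'M_n)).
  by apply/matrixP => i j; rewrite !mxE.
by rewrite rep_nf // nf_up rank_pid_mx.
Qed.

End Representatives.

End NormalForm.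

(** * Semistability *)

Section Stability.
Variables (C : numClosedFieldType) (n r s : nat).
Hypotheses (hr : (r < n)%N) (hs : (s < n)%N) (s_gt0 : (0 < s)%N).
Notation fn := (SL C n -> C).
Notation R := (@inv_sections C n r s).
Notation loR := (lo (ltnW hr)).
Notation Q := (@Q C n r s).
Notation semistable := (@semistable C n r s).
Implicit Types (g h u : SL C n) (F : fn).

Lemma Q_semistable g g' : Q g = Q g' -> semistable g -> semistable g'.
Proof.
move=> E [d [F [d0 RF Fg]]]; exists d, F; split=> //; apply/eqP => Fg'.
have /(QE hr hs)[_ E'] : Q g d F by rewrite E; apply/(QE hr hs).
by rewrite E' eqxx in Fg.
Qed.

Lemma Q_lambda t (t0 : t != 0) g : Q (lamSL hs t0 * g)%g = Q g.
Proof. by apply: (Q_eq hr hs) => d F RF; rewrite (inv_lamSL _ _ _ RF). Qed.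

Section Weight.
Variable k : nat.
Hypotheses (ks : (k <= s)%N) (kr : (k <= r)%N) (rk : (r - k <= n - s)%N).
Notation rep := (rep hr hs ks kr rk).

Lemma orbit_rep g : rk_down hr hs g = (r - k)%N ->
  exists2 h, Hgrp s h & Q g = Q (h * rep (nfX C n s k (rk_up hr hs g)))%g.
Proof.
move=> gk; have km : (k <= rk_up hr hs g)%N by have := rk_sum hr hs g; lia.
have [h [t [a [hH t0]]]] := normal_form hr hs g s_gt0.
rewrite gk subKn // => E; exists h => //.
have [u pu gE] : exists2 u, parabolic r u (\det a) &
    g = ((h * lamSL hs t0) * rep (nfX C n s k (rk_up hr hs g)) * u)%g.
  apply: (colsub_parabolic (hr := hr) hs); rewrite E; congr (_ *m _).
  have EC (A B : 'M[C]_n) : colsub loR (A *m B) = A *m colsub loR B.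
    by apply/matrixP => i j; rewrite !mxE; apply: eq_bigr => l _; rewrite !mxE.
  by rewrite [RHS]EC rep_nf //= mulmxA.
by rewrite [in LHS]gE (Q_parabolic hr hs _ pu) Hgrp_lambda // -mulgA Q_lambda.
Qed.

(** The action of lambda(t) on the frame differs from the substitution of [t ^+ n *: X] for [X] by a
    diagonal element of P, whose character is the weight of the frame. *)
Lemma rep_scale d F X t : R d F -> t != 0 ->
  F (rep X) = (t ^ ((n * k)%N%:Z - (r * s)%N%:Z)) ^+ d * F (rep (t ^+ n *: X)).
Proof.
move=> RF t0; rewrite -(inv_lamSL hs t0 _ RF).
have [u pu ->] : exists2 u, parabolic r u
    (\det (diag_mx (\row_i lam s t (idx s hr k k i)))) &
    (lamSL hs t0 * rep X)%g = (rep (t ^+ n *: X) * u)%g.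
  apply: (colsub_parabolic (hr := hr) hs); rewrite rep_col.
  have EC q (f : 'I_q -> 'I_n) (A B : 'M[C]_n) : colsub f (A *m B) = A *m colsub f B.
    by apply/matrixP => i j; rewrite !mxE; apply: eq_bigr => l _; rewrite !mxE.
  rewrite [LHS]EC rep_col -EC.
  have -> : lambda n s t *m uniS X = uniS (t ^+ n *: X) *m lambda n s t.
    rewrite (lambda_blockn hs) /uniS !(blockn_mul (ltnW hs)).
    rewrite !(mulmx0, mul0mx, mul1mx, mulmx1, addr0, add0r) mul_scalar_mx mul_mx_scalar.
    rewrite scalerA mulrC; congr (blockn _ (_ *: _) _ _).
    by rewrite -{2}(subnK (ltnW hs)) exprD mulfK // expf_neq0.
  apply/matrixP => i j; by rewrite /lambda !mul_mx_diag !mxE.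
rewrite (section_parabolic _ RF.1 pu) det_diag; congr (_ ^+ _ * _).
rewrite -(wt_idx hr hs (leqnn k) ks kr rk) -(prod_lam hs) //.
by apply: eq_bigr => i _; rewrite mxE.
Qed.

Lemma rep_regular F (G : C -> 'M[C]_(s, n - s)) (h : SL C n) : regular_fun F ->
  (forall a b, exists q : {poly C}, (fun e => G e a b) = horner q) ->
  exists q : {poly C}, forall e, F (h * rep (G e))%g = q.[e].
Proof.
move=> Fr Gq.
have sa := subalg_horner C; have [SC _ _] := sa.
have [q qE] : [set f : C -> C | exists q : {poly C}, f = horner q]
    (fun e => F (h * rep (G e))%g).
  apply: (regular_comp (G := fun e => (h * rep (G e))%g)) => //.
  apply: subalg_mul => //; apply: subalg_mul => // i j.
  case: (lo_hiP (ltnW hs) i) => [] [i' ->]; case: (lo_hiP (ltnW hs) j) => [] [j' ->].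
  - by rewrite (_ : (fun t => _) = (fun=> (i' == j')%:R)) //; apply/funext => e;
      exact: uniS_ll.
  - by rewrite (_ : (fun t => _) = (fun e => G e i' j')) //; apply/funext => e;
      exact: uniS_lh.
  - by rewrite (_ : (fun t => _) = (fun=> 0)) //; apply/funext => e; exact: uniS_hl.
  - by rewrite (_ : (fun t => _) = (fun=> (i' == j')%:R)) //; apply/funext => e;
      exact: uniS_hh.
by exists q => e; rewrite -[RHS](congr1 (@^~ e) qE).
Qed.

Lemma unstable_rep0 d F : (0 < d)%N -> R d F -> (n * k <> r * s)%N -> F (rep 0) = 0.
Proof.
(* Any nonzero [t] that is not a root of unity would do. *)
move=> d0 RF nk; have t0 : (2 : C) != 0 by rewrite pnatr_eq0.
have /eqP := rep_scale 0 RF t0; rewrite scaler0 -subr_eq0 -{1}[F _]mul1r -mulrBl.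
rewrite mulf_eq0 => /orP[|/eqP //]; rewrite subr_eq0 eq_sym exprnP exprz_exp.
rewrite pexprz_eq1 ?ler0n // pnatr_eq1 orbF => /eqP H; exfalso.
have : (n * k)%N%:Z - (r * s)%N%:Z = 0 by apply/eqP; move/eqP: H; rewrite mulf_eq0; lia.
lia.
Qed.

(** By [rep_scale], [F (rep X)] equals a positive power of [t] times a polynomial in [t], for all
    [t != 0]; at [t = 0] it is 0. *)
Lemma unstable_rep_gt d F X : (0 < d)%N -> R d F -> (r * s < n * k)%N -> F (rep X) = 0.
Proof.
move=> d0 RF lt.
have [P PE] : exists P : {poly C}, forall e, F (1 * rep (e *: X))%g = P.[e].
  apply: (rep_regular (G := fun e => e *: X)); first exact: RF.1.1.
  move=> a b; exists (X a b *: 'X); apply/funext => e.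
  by rewrite hornerZ hornerX mxE mulrC.
pose q := (F (rep X))%:P - 'X^((n * k - r * s) * d) * (P \Po 'X^n).
have /(congr1 (fun q : {poly C} => q.[0])) : q = 0.
  apply: poly_eq0_nonzero => t t0; rewrite /q hornerD hornerN hornerM hornerC.
  rewrite horner_comp !hornerXn -PE mul1g (rep_scale X RF t0) subzn ?(ltnW lt) //.
  by rewrite -exprnP exprM subrr.
rewrite /q hornerD hornerN hornerM hornerC hornerXn expr0n muln_eq0.
by rewrite subn_eq0 leqNgt lt /= gtn_eqF //= mul0r subr0 horner0.
Qed.

End Weight.

Lemma rk_up_Hgrp h g : Hgrp s h -> (rk_up hr hs (h * g)%g <= rk_up hr hs g)%N.
Proof.
move=> [a [b [_ _ hE]]]; rewrite /rk_up /= (mxsub_mul_lo_hi (ltnW hs)) hE.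
by rewrite blockn_ul blockn_ur mul0mx addr0 mxrankM_maxr.
Qed.

Variable p : nat.
Hypotheses (pE : p = (r + s - n)%N) (p_lo : (n * p < r * s)%N)
  (p_hi : (r * s < n * p.+1)%N).

Fact p_le_s : (p <= s)%N. Proof. lia. Qed.
Fact p_le_r : (p <= r)%N. Proof. lia. Qed.
Fact rp_le : (r - p <= n - s)%N. Proof. lia. Qed.
Notation repp := (rep hr hs p_le_s p_le_r rp_le).
Notation nfp := (nfX C n s p).

(** The lower rank is at most [minn r (n - s)], which is [r - p], so [k >= p]. If [k > p] the weight
    of the frame is positive. If [k = p] and the upper rank is [p], the representative is [rep 0],
    whose frame has nonzero weight. *)
Lemma semistable_rk g : semistable g ->
  rk_down hr hs g = (r - p)%N /\ (p < rk_up hr hs g <= minn r s)%N.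
Proof.
move=> ss; have le1 := rk_down_le hr hs g; have le2 := rk_up_le hr hs g.
have le3 := rk_sum hr hs g; pose k := (r - rk_down hr hs g)%N.
have ks : (k <= s)%N by rewrite /k; lia.
have kr : (k <= r)%N by rewrite /k; lia.
have rk : (r - k <= n - s)%N by rewrite /k; lia.
have gk : rk_down hr hs g = (r - k)%N by rewrite /k; lia.
have [h hH Qg] := orbit_rep ks kr rk gk.
have [d [F [d0 RF Fg]]] := Q_semistable Qg ss.
have RFh := inv_sections_translate hs hH RF.
have pk : (p <= k)%N by rewrite /k; lia.
have kp : k = p.
  apply/eqP; rewrite eqn_leq pk andbT leqNgt; apply/negP => ltpk; case/eqP: Fg.
  apply: (unstable_rep_gt ks kr rk _ d0 RFh).
  by apply: leq_trans p_hi _; rewrite leq_mul2l ltpk orbT.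
split; first by rewrite gk kp.
rewrite le2 andbT ltn_neqAle; apply/andP; split; last by rewrite /k in kp; lia.
apply/eqP => up; case/eqP: Fg.
have -> : nfX C n s k (rk_up hr hs g) = 0.
  apply/matrixP => a b; rewrite !mxE -up -kp.
  by case: eqP => //= ->; rewrite ltnNge leq_addr.
apply: (unstable_rep0 ks kr rk d0 RFh); rewrite kp; lia.
Qed.

Lemma separating_section m : (p < m <= minn r s)%N -> exists d F,
  [/\ (0 < d)%N, R d F, forall g, F g != 0 -> (m <= rk_up hr hs g)%N
    & forall l, (m <= l)%N -> F (repp (nfp l)) = 1].
Proof.
rewrite leq_min => /and3P[pm mr ms].
(* The Plücker coordinates of [idx p p] and [idx p m] have weights [- b] and [a]; with exponents [a]
   and [b] they cancel. *)
pose a := (n * m - r * s)%N; pose b := (r * s - n * p)%N.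
have lem : (n * p.+1 <= n * m)%N by rewrite leq_mul2l pm orbT.
pose w := nseq a (idx s hr p p) ++ nseq b (idx s hr p m).
have w0 : wtm s w = 0.
  rewrite /wtm big_cat /= !big_nseq !iter_addr_0.
  rewrite (wt_idx hr hs (leqnn p) p_le_s p_le_r rp_le) (wt_idx hr hs
      (ltnW pm) ms mr rp_le).
  have aE : a%:Z = (n * m)%N%:Z - (r * s)%N%:Z by rewrite subzn // /a; lia.
  have bE : b%:Z = (r * s)%N%:Z - (n * p)%N%:Z by rewrite subzn // /b; lia.
  by rewrite -mulr_natr -[X in _ + X]mulr_natr !natz aE bE; ring.
exists (size w), (mon hr w); split.
- by rewrite size_cat !size_nseq /b; lia.
- exact: inv_mon.
- move=> g; rewrite mon_cat !mon_nseq mulf_eq0 negb_or => /andP[_].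
  rewrite expf_eq0 negb_and => /orP[|]; first by rewrite /b; lia.
  exact: (rk_up_pl hs (ltnW pm) ms mr rp_le).
- move=> l ml; rewrite mon_cat !mon_nseq !plE.
  have E m' : (p <= m')%N -> (m' <= m)%N ->
      mxsub (idx s hr p m') loR (repp (nfp l) : 'M_n) = 1%:M.
    move=> pm' m'm; rewrite -(idx_nf C hr hs pm' _ _ rp_le (leq_trans m'm ml)); try lia.
    rewrite -(rep_nf C hr hs p_le_s p_le_r rp_le); last lia.
    by apply/matrixP => i j; rewrite !mxE.
  by rewrite !E ?det1 ?expr1n ?mulr1 // ltnW.
Qed.

End Stability.

(** * Orbits *)

Section Orbits.
Variables (C : numClosedFieldType) (n r s p : nat).
Hypothesis uncountableC : ~ countable [set: C].
Hypotheses (hr : (r < n)%N) (hs : (s < n)%N) (s_gt0 : (0 < s)%N).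
Hypotheses (pE : p = (r + s - n)%N) (p_lo : (n * p < r * s)%N)
  (p_hi : (r * s < n * p.+1)%N).
Notation fn := (SL C n -> C).
Notation R := (@inv_sections C n r s).
Notation loR := (lo (ltnW hr)).
Notation loS := (lo (ltnW hs)).
Notation Q := (@Q C n r s).
Notation semistable := (@semistable C n r s).
Implicit Types (g h u : SL C n) (F : fn).

Let ps : (p <= s)%N := p_le_s hr hs s_gt0 pE p_lo p_hi.
Let pr : (p <= r)%N := p_le_r hr hs s_gt0 pE p_lo p_hi.
Let rp : (r - p <= n - s)%N := rp_le hr hs s_gt0 pE p_lo p_hi.
Notation rep := (rep hr hs ps pr rp).
Notation nfp := (nfX C n s p).
Notation rku := (rk_up hr hs).

Definition cellX (A : 'M[C]_(s - p, r - p)) : 'M[C]_(s, n - s) :=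
  shift_mx C p s (s - p) *m A *m pid_mx (r - p).

Lemma cellX_shift A (a : 'I_s) (b : 'I_(n - s)) (i : 'I_(s - p)) (j : 'I_(r - p)) :
  a = (p + i)%N :> nat -> b = j :> nat -> cellX A a b = A i j.
Proof.
move=> ai bj; rewrite /cellX -mulmxA (shift_mx_mul _ _ ai) mxE (bigD1 j) //=.
rewrite mxE bj eqxx ltn_ord mulr1 big1 ?addr0 // => j' jj'.
by rewrite mxE bj val_eqE (negbTE jj') mulr0.
Qed.

Lemma cellX_lt A (a : 'I_s) b : (a < p)%N -> cellX A a b = 0.
Proof. by move=> ap; rewrite /cellX -mulmxA shift_mx_mul0 // => i; lia. Qed.

(** This places the matrix coordinates of the Schubert cell inside the family [rep], after which
    only the rank of [A] matters. *)
Lemma cell_ptE A : @cell_pt C n r s p A = SLact (rep (cellX A)) (base_pt C n r).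
Proof.
rewrite /SLact /base_pt limg_span /cell_pt; congr (<<_>>%VS).
have sz : size ([seq evec C n i | i <- iota 1 p] ++
    [seq (evec C n (s + j.+1) + \sum_(i < s - p) A i j *: evec C n (p + i.+1))%R
      | j : 'I_(r - p)]) = r.
  by rewrite size_cat size_map size_iota size_image card_ord subnKC.
apply: (@eq_from_nth _ 0); first by rewrite sz !size_map size_iota.
rewrite sz => i lti; rewrite (nth_map 0) ?size_map ?size_iota //.
rewrite (nth_map 0%N) ?size_iota // nth_iota // add1n lfunE /=.
rewrite -[i in evec C n i.+1]/(nat_of_ord (loR (Ordinal lti))) mulmx_evec.
have -> : col (loR (Ordinal lti)) (rep (cellX A) : 'M_n) =
    col (idx s hr p p (Ordinal lti)) (uniS (cellX A)).
  have := rep_col hr hs ps pr rp (cellX A) => /matrixP E.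
  by apply/colP => a; have := E a (Ordinal lti); rewrite !mxE.
rewrite nth_cat size_map size_iota; case: ltnP => [ip|pi].
  rewrite (nth_map 0%N) ?size_iota // nth_iota // add1n.
  rewrite (idx_lo hr hs ps pr rp (i := Ordinal lti) ip).
  apply/colP => a; rewrite [LHS]mxE [RHS]mxE eqSS.
  case: (lo_hiP (ltnW hs) a) => [] [a' ->]; first by rewrite uniS_ll -val_eqE.
  by rewrite uniS_hl (_ : (_ == _) = false) //=; apply/negbTE; lia.
have ltj : (i - p < r - p)%N by lia.
rewrite -[(i - p)%N]/(nat_of_ord (Ordinal ltj)) /image_mem (nth_map
    (Ordinal ltj)) ?size_enum_ord //.
rewrite nth_ord_enum (idx_hi hr hs ps pr rp (i := Ordinal lti) pi).
apply/colP => a; rewrite [LHS]mxE [RHS]mxE summxE [evec _ _ _ _ _]mxE.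
case: (lo_hiP (ltnW hs) a) => [] [a' ->].
  have lta' := ltn_ord a'.
  rewrite uniS_lh (_ : (_ == _) = false) ?add0r; last by apply/negbTE => /=; lia.
  have [a'p|pa'] := ltnP a' p.
    rewrite cellX_lt // big1 // => k _; rewrite !mxE (_ : (_ == _) = false) ?mulr0 //=.
    by apply/negbTE; lia.
  have lta : (a' - p < s - p)%N by lia.
  rewrite (@cellX_shift A _ _ (Ordinal lta) (Ordinal ltj)) /= ?subnKC //.
  rewrite (bigD1 (Ordinal lta)) //= !mxE /= (_ : (_ == _) = true) ?mulr1;
      last by apply/eqP; lia.
  rewrite big1 ?addr0 // => k ka; rewrite !mxE /= (_ : (_ == _) = false) ?mulr0 //.
  by apply/negbTE; move: ka; rewrite -val_eqE /=; lia.
rewrite uniS_hh big1 ?addr0 => [|k _].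
  by rewrite -val_eqE /=; congr (_%:R); apply/eqP/eqP; lia.
by rewrite !mxE /= (_ : (_ == _) = false) ?mulr0 //; apply/negbTE;
    have := ltn_ord k; lia.
Qed.

Lemma rk_up_cell A : rku (rep (cellX A)) = (p + \rank A)%N.
Proof.
pose M := mxsub loS loR (rep (cellX A) : 'M_n); rewrite /rk_up -/M.
have rk_cast a a' b b' (e1 : a' = a) (e2 : b' = b) (N : 'M[C]_(a, b)) :
    \rank (mxsub (cast_ord e1) (cast_ord e2) N) = \rank N.
  move: N; case: a / e1; case: b / e2 => N; congr (\rank _).
  by apply/matrixP => i j; rewrite mxE !cast_ord_id.
rewrite -(rk_cast _ _ _ _ (subnKC ps) (subnKC pr)).
have -> : mxsub (cast_ord (subnKC ps)) (cast_ord (subnKC pr)) M = block_mx 1%:M 0 0 A.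
  have ME a i : M a i = uniS (cellX A) (loS a) (idx s hr p p i).
    have /matrixP/(_ (loS a) i) := rep_col hr hs ps pr rp (cellX A).
    by rewrite !mxE.
  apply/matrixP => a i; rewrite mxE ME.
  case: (split_ordP a) => a' ->; case: (split_ordP i) => i' ->.
  - have lt : (cast_ord (subnKC pr) (lshift (r - p) i') < p)%N by rewrite /=.
    by rewrite (idx_lo hr hs ps pr rp lt) uniS_ll block_mxEul mxE -val_eqE.
  - have le : (p <= cast_ord (subnKC pr) (rshift p i'))%N by rewrite /= leq_addr.
    by rewrite (idx_hi hr hs ps pr rp le) uniS_lh block_mxEur cellX_lt ?mxE /=.
  - have lt : (cast_ord (subnKC pr) (lshift (r - p) i') < p)%N by rewrite /=.
    rewrite (idx_lo hr hs ps pr rp lt) uniS_ll block_mxEdl mxE (_ :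
        (_ == _) = false) //.
    by apply/negbTE; rewrite -val_eqE /=; have := ltn_ord i'; lia.
  - have le : (p <= cast_ord (subnKC pr) (rshift p i'))%N by rewrite /= leq_addr.
    rewrite (idx_hi hr hs ps pr rp le) uniS_lh block_mxEdr.
    by apply: cellX_shift => //=; rewrite addKn.
by rewrite rank_diag_block_mx mxrank1.
Qed.

(** All cell points of rank [t] are H-translates of one normal form, up to lambda and P, and [P_sr]
    lies in H; hence O_t is the set of H-translates of that form. *)
Lemma OsetE t : (t <= minn (r - p) (s - p))%N ->
  @Oset C n r s p t = [set Q (h * rep (nfp (p + t)))%g | h in @Hgrp C n s].
Proof.
rewrite leq_min => /andP[tr ts].
have cellQ A : \rank A = t -> exists2 h, Hgrp s h &
    quot_pt r s (@cell_pt C n r s p A) = Q (h * rep (nfp (p + t)))%g.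
  move=> rA; rewrite cell_ptE -/(Q _) -rA -rk_up_cell.
  apply: (orbit_rep s_gt0 ps pr rp); exact: rep_rk_down.
apply/seteqP; split=> [_ [[a b] [_ [h [_ [hH [A rA <-] ->]]] [q [_ qH] [<- <-]]] <-]|].
  rewrite /=; have [h1 h1H ->] := cellQ A rA; exists (h * h1)%g; first exact: HgrpM.
  rewrite (pt_act_Q hr hs) // (pt_act_Q hr hs); last exact/HgrpM/HgrpV.
  by rewrite -!mulgA mulKg.
move=> _ [h hH <-].
have [h1 h1H E] := cellQ (pid_mx t) (rank_pid_mx C ts tr).
exists (((h * h1^-1) * 1%g^-1)%g, pt_act r s 1%g (Q (h1 * rep (nfp (p + t)))%g)) => /=.
  exists (assoc_class r s p (h * h1^-1)%g (Q (h1 * rep (nfp (p + t))))%g).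
    exists (h * h1^-1)%g, (Q (h1 * rep (nfp (p + t))))%g; split=> //.
      exact/HgrpM/HgrpV.
    by exists (pid_mx t) => //; exact: rank_pid_mx.
  exists 1%g => //; split; last exact: Hgrp1.
  rewrite /= (_ : SLact (1%g : SL C n) = id) ?image_id //; apply/funext => W.
  rewrite /SLact -[RHS]lim1g; congr (_ @: _)%VS.
  by apply/lfunP => v; rewrite !lfunE /= mul1mx.
rewrite (pt_act_Q hr hs); last exact: Hgrp1.
rewrite (pt_act_Q hr hs); last by rewrite invg1 mulg1; exact/HgrpM/HgrpV.
by rewrite invg1 mulg1 mul1g -!mulgA mulKg.
Qed.

Lemma semistable_nf t h : (1 <= t <= minn (r - p) (s - p))%N -> Hgrp s h ->
  semistable (h * rep (nfp (p + t)))%g.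
Proof.
rewrite leq_min => /and3P[t0 tr ts] hH.
have [|d [F [d0 RF _ F1]]] := separating_section C hr hs s_gt0 pE p_lo p_hi (m := p.+1).
  by rewrite leq_min; lia.
exists d, (fun g => F (h^-1 * g)%g); split=> //.
  by apply: inv_sections_translate => //; exact: HgrpV.
by rewrite mulKg F1 ?oner_eq0 //; lia.
Qed.

Lemma H_orbit_nf t h : Hgrp s h -> (t <= minn (r - p) (s - p))%N ->
  H_orbit r s (Q (h * rep (nfp (p + t)))%g) = @Oset C n r s p t.
Proof.
move=> hH tle; rewrite OsetE //; apply/seteqP; split=> [_ [h1 h1H <-]|_ [h1 h1H <-]].
  by rewrite (pt_act_Q hr hs) // mulgA; exists (h1 * h)%g => //; exact: HgrpM.
exists (h1 * h^-1)%g; first exact/HgrpM/HgrpV.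
rewrite (pt_act_Q hr hs); last exact/HgrpM/HgrpV.
by rewrite -!mulgA mulKg.
Qed.

Lemma Oset_orbit t : (1 <= t <= minn (r - p) (s - p))%N ->
  H_orbits r s (@Oset C n r s p t).
Proof.
move=> tP; have /andP[_ tle] := tP.
exists (Q (1 * rep (nfp (p + t)))%g); last by apply: H_orbit_nf => //; exact: Hgrp1.
by apply: (Q_closed hr hs); apply: semistable_nf => //; exact: Hgrp1.
Qed.

Lemma H_orbitsE : @H_orbits C n r s =
  [set @Oset C n r s p t | t in [set t | (1 <= t <= minn (r - p) (s - p))%N]].
Proof.
apply/seteqP; split=> [_ [x Xx <-]|_ [t tP <-]]; last exact: Oset_orbit.
have [g ss ->] := closed_point_Q hr hs uncountableC Xx.
have [gd /andP[gu1 gu2]] := semistable_rk hr hs s_gt0 pE p_lo p_hi ss.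
have [h hH ->] := orbit_rep s_gt0 ps pr rp gd.
rewrite leq_min in gu2; case/andP: gu2 => gr gs.
have tP : (1 <= rku g - p <= minn (r - p) (s - p))%N by rewrite leq_min; lia.
exists (rku g - p)%N => //; have /andP[_ tle] := tP.
by rewrite -(H_orbit_nf hH tle) subnKC // ltnW.
Qed.

Lemma Oset_closure t1 t2 : (1 <= t1)%N -> (t1 <= t2 <= minn (r - p) (s - p))%N ->
  @Oset C n r s p t1 `<=` zariski_closure R (@Oset C n r s p t2).
Proof.
move=> t10 /andP[t12 t2P] y; have t1P := leq_trans t12 t2P.
rewrite OsetE // => -[h hH <-].
have ss1 : semistable (h * rep (nfp (p + t1)))%g by apply: semistable_nf => //;
    rewrite t10.
split; first exact: (Q_closed hr hs).
move=> Z [[J idJ ->] sub]; split; first exact: (Q_Proj hr hs).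
move=> d F JF; have RF : R d F by case: idJ => sub' _ _ _; apply: sub' JF.
apply/(QE hr hs); split=> //.
(* For [e != 0] the invertible [D e] changes neither rank, so the point stays in O_{t2}; at [e = 0]
   the normal form for [t2] becomes that for [t1]. *)
pose dg e (a : nat) : C := if (a < p + t1)%N then 1 else e.
pose D e : 'M[C]_s := diag_mx (\row_a dg e a).
have [q qE] : exists q : {poly C}, forall e,
    F (h * rep (D e *m nfp (p + t2)))%g = q.[e].
  apply: rep_regular => [|a b]; first exact: RF.1.1.
  exists ((if (a < p + t1)%N then 1 else 'X) * (nfp (p + t2) a b)%:P).
  apply/funext => e; rewrite mul_diag_mx hornerM hornerC !mxE /dg.
  by case: ifP => _; rewrite ?hornerC ?hornerX.
have q0 : q = 0.
  apply: poly_eq0_nonzero => e e0; rewrite -qE.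
  have rd := rep_rk_down hr hs ps pr rp (D e *m nfp (p + t2)).
  have ru : rku (rep (D e *m nfp (p + t2))) = (p + t2)%N.
    rewrite -[RHS](rep_nf_rk_up C hr hs ps pr rp (leq_addr t2 p)); last first.
      by move: t2P; rewrite !leq_min; lia.
    have De : D e \in unitmx.
      rewrite unitmxE det_diag unitfE prodf_seq_neq0; apply/allP => a _ /=.
      by rewrite mxE /dg; case: ifP; rewrite ?oner_eq0.
    rewrite /rk_up -[RHS](eqmxMfull _ (_ : row_full (D e))) ?row_full_unit //.
    congr (\rank _); apply/matrixP => a i; rewrite [in RHS]/D [in RHS]mul_diag_mx.
    have E X : mxsub loS loR (rep X : 'M_n) a i = uniS X (loS a) (idx s hr p p i).
      by have /matrixP/(_ (loS a) i) := rep_col hr hs ps pr rp X; rewrite !mxE.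
    rewrite [RHS]mxE !E [in RHS]mxE.
    have [ip|pi] := ltnP i p; [rewrite (idx_lo hr hs ps pr rp ip)|rewrite
        (idx_hi hr hs ps pr rp pi)].
      rewrite !uniS_ll /dg -val_eqE /=; case: eqP => [->|]; rewrite ?mulr0 // mulr1.
      by rewrite ifT //; lia.
    by rewrite !uniS_lh /D mul_diag_mx !mxE.
  have [h1 h1H E1] := orbit_rep s_gt0 ps pr rp rd; rewrite ru in E1.
  have Qin : @Oset C n r s p t2 (Q (h * rep (D e *m nfp (p + t2)))%g).
    rewrite OsetE //; exists (h * h1)%g; first exact: HgrpM.
    by rewrite -[RHS](pt_act_Q hr hs _ hH) E1 (pt_act_Q hr hs _ hH) -mulgA.
  have [_ /(_ d F JF)] := sub _ Qin.
  by move=> /(QE hr hs)[].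
have -> : nfp (p + t1) = D 0 *m nfp (p + t2).
  apply/matrixP => a b; rewrite mul_diag_mx !mxE /dg.
  case: eqP => [E|]; rewrite ?mulr0 //=; case: ifP => lt; rewrite ?mul0r ?mul1r //.
  by rewrite (leq_trans lt) // leq_add2l.
by rewrite qE q0 horner0.
Qed.

Lemma Oset_not_closure t1 t2 : (1 <= t2)%N -> (t2 < t1 <= minn (r - p) (s - p))%N ->
  ~ @Oset C n r s p t1 `<=` zariski_closure R (@Oset C n r s p t2).
Proof.
move=> t20 /andP[t21 t1P] sub.
have t2P : (t2 <= minn (r - p) (s - p))%N by apply: leq_trans t1P; apply: ltnW.
have [|d [F [d0 RF Fup F1]]] := separating_section C hr hs s_gt0 pE p_lo p_hi (m :=
    (p + t2).+1).
  by move: t1P; rewrite !leq_min; lia.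
have : @Oset C n r s p t1 (Q (1 * rep (nfp (p + t1)))%g).
  by rewrite OsetE //; exists 1%g => //; exact: Hgrp1.
(* [J] is the ideal of all invariant sections vanishing on O_{t2}. The separating section for upper
   rank [p + t2 + 1] belongs to it, yet equals 1 at the chosen point of O_{t1}. *)
move=> /sub[_]; pose J e : set fn := [set G | R e G /\
    forall y, @Oset C n r s p t2 y -> y e G].
have O2 y : @Oset C n r s p t2 y ->
    exists h, [/\ Hgrp s h, semistable (h * rep (nfp (p + t2)))%g
    & y = Q (h * rep (nfp (p + t2)))%g].
  by rewrite OsetE // => -[h hH <-]; exists h; split=> //;
      apply: semistable_nf => //; rewrite t20.
have idy y : @Oset C n r s p t2 y -> homog_ideal R y.
  by move=> /O2[h [_ _ ->]]; exact: Q_homog_ideal.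
have idJ : homog_ideal R J.
  split=> [e G []//|e|e G G' [RG JG] [RG' JG']|e e' G G' RG [RG' JG']].
  - by split=> [|y /idy[]//]; exact: inv_sections0.
  - split=> [|y yO]; first exact: inv_sectionsB.
    by have [_ _ yB _] := idy _ yO; apply: yB; [exact: JG|exact: JG'].
  - split=> [|y yO]; first exact: inv_sectionsM.
    by have [_ _ _ yM] := idy _ yO; apply: yM => //; exact: JG'.
move=> /(_ [set y | Proj R y /\ forall e, J e `<=` y e])[].
  split; first by exists J.
  move=> y yO; split; last by move=> e G [_]; apply.
  by have [h [_ ss ->]] := O2 _ yO; exact: (Q_Proj hr hs).
move=> _ /(_ d F)[].
  split=> // y /O2[h [hH _ ->]]; apply/(QE hr hs); split=> //.
  apply/eqP; apply: contraT => /Fup.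
  have := rk_up_Hgrp hr hs (rep (nfp (p + t2))) hH.
  rewrite (rep_nf_rk_up C hr hs ps pr rp (leq_addr t2 p)); first lia.
  by move: t2P; rewrite !leq_min; lia.
move=> _ /(_ _ erefl); rewrite mul1g F1 ?leq_add2l // ; last by lia.
by move/eqP; rewrite oner_eq0.
Qed.

End Orbits.

(** * The classification of orbits and their number *)

Local Open Scope card_scope.

Theorem H_orbits_quotient (C : numClosedFieldType) (n r s p : nat) :
  ~ countable [set: C] -> (2 <= n)%N -> (1 <= r <= n - 1)%N -> (1 <= s <= n - 1)%N ->
  p = ((r * s) %/ n)%N -> p = 0%N \/ (n <= r + s)%N /\ p = (r + s - n)%N ->
  [/\ (forall t, (1 <= t <= minn (r - p) (s - p))%N ->
         @H_orbits C n r s (@Oset C n r s p t)) /\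
      @H_orbits C n r s =
        [set @Oset C n r s p t
          | t in [set t : nat | (1 <= t <= minn (r - p) (s - p))%N]],
      @H_orbits C n r s #= `I_(minn (r - p) (s - p))
    & forall t1 t2,
        (1 <= t1 <= minn (r - p) (s - p))%N -> (1 <= t2 <= minn (r - p) (s - p))%N ->
        (@Oset C n r s p t1 `<=`
           zariski_closure (@inv_sections C n r s) (@Oset C n r s p t2)
         <-> (t1 <= t2)%N)].
Proof.
move=> uC hn hr hs hp hp'.
have rn : (r < n)%N by lia.
have sn : (s < n)%N by lia.
have s0 : (0 < s)%N by lia.
have n0 : (0 < n)%N by lia.
have p_hi : (r * s < n * p.+1)%N by rewrite hp [ltnRHS]mulnC; exact: ltn_ceil.
(* If [p = 0] then [r * s < n], and [(r - 1) * (s - 1) >= 0] gives [r + s <= n], so the truncated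
   difference is 0. *)
have pE : p = (r + s - n)%N by case: hp' => [p0|[_ //]]; move: p_hi; rewrite p0; nia.
(* When [r + s >= n], the difference [r * s - n * p] is [(n - r) * (n - s)]. *)
have p_lo : (n * p < r * s)%N by rewrite pE; case: (leqP n (r + s)); nia.
have cl t1 t2 : (1 <= t1 <= minn (r - p) (s - p))%N ->
    (1 <= t2 <= minn (r - p) (s - p))%N ->
    (@Oset C n r s p t1 `<=` zariski_closure (@inv_sections C n r s)
        (@Oset C n r s p t2)
     <-> (t1 <= t2)%N).
  move=> /andP[t10 t1P] /andP[t20 t2P]; split=> [sub|le].
    rewrite leqNgt; apply/negP => lt.
    by apply: (@Oset_not_closure C n r s p) sub => //; rewrite lt.
  by apply: (@Oset_closure C n r s p) => //; rewrite le.
have HE := @H_orbitsE C n r s p uC rn sn s0 pE p_lo p_hi.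
split=> //; first by split=> // t tP; apply: (@Oset_orbit C n r s p).
rewrite HE; set m := minn (r - p) (s - p).
have -> : [set t : nat | (1 <= t <= m)%N] = succn @` `I_m.
  apply/seteqP; split=> [[|t]//= tm|_ [t tm <-]//].
  by exists t.
(* Equal orbits lie in each other's closure, so the closure relations in both directions identify
   their indices. *)
rewrite image_comp; apply: inj_card_eq => t1 t2; rewrite !inE /= => t1m t2m E.
have le12 : (t1.+1 <= t2.+1)%N by apply/(cl t1.+1 t2.+1 t1m t2m); rewrite E;
    apply/(cl t2.+1 t2.+1 t2m t2m).
have le21 : (t2.+1 <= t1.+1)%N by apply/(cl t2.+1 t1.+1 t2m t1m); rewrite E;
    apply/(cl t2.+1 t2.+1 t2m t2m).
by apply/eqP; rewrite eqn_leq -ltnS le12 -ltnS le21.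
Qed.

Local Close Scope ring_scope.

Theorem proposition3p10 (R : realType) (n r s p : nat)
  (hn : 2 <= n) (hr : 1 <= r <= n - 1) (hs : 1 <= s <= n - 1)
  (hp : p = (r * s) %/ n)
  (hp' : p = 0 \/ (n <= r + s /\ p = r + s - n)) :
  [/\ (* (1) *)
      (forall t, 1 <= t <= minn (r - p) (s - p) ->
         @H_orbits R[i] n r s (@Oset R[i] n r s p t)) /\
      @H_orbits R[i] n r s =
        [set @Oset R[i] n r s p t
          | t in [set t : nat | 1 <= t <= minn (r - p) (s - p)]],
      (* (2) *)
      @H_orbits R[i] n r s #= `I_(minn (r - p) (s - p))
    & (* (3) *)
      forall t1 t2,
        1 <= t1 <= minn (r - p) (s - p) -> 1 <= t2 <= minn (r - p) (s - p) ->
        (@Oset R[i] n r s p t1 `<=`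
           zariski_closure (@inv_sections R[i] n r s) (@Oset R[i] n r s p t2)
         <-> t1 <= t2)].
Proof. exact: H_orbits_quotient (@uncountable_complex R) hn hr hs hp hp'. Qed.
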